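(* Let $\mathbb{K}$ be a field of characteristic $0$. There exists a hyperplane arrangement $\mathcal{A}=\{V(\ell_1),\dots,V(\ell_d)\}$ with Artinian Orlik-Terao ideal $I_{\mathcal{A}}\subset S=\mathbb{K}[y_1,\dots,y_d]$ such that the Artinian Orlik-Terao algebra $S/I_{\mathcal{A}}$ has the Weak Lefschetz Property, but for every monomial order $\prec$ on $S$ the algebra $S/\mathrm{in}_\prec(I_{\mathcal{A}})$ does not have the Weak Lefschetz Property.
   Context: Artinian Orlik-Terao (AOT) algebra: let $\mathcal{A}=\{H_1,\dots,H_d\}$ be a central hyperplane arrangement, $H_i=V(\ell_i)$ with $\ell_1,\dots,\ell_d$ nonzero, pairwise non-proportional homogeneous linear forms in $x_1,\dots,x_n$ with coefficients in $\mathbb{K}$, and let $S=\mathbb{K}[y_1,\dots,y_d]$. For each subset $\Lambda=\{i_1,\dots,i_k\}\subseteq\{1,\dots,d\}$ with $\mathrm{codim}(H_{i_1}\cap\dots\cap H_{i_k})<k$ and each nontrivial linear relation $\sum_{t\in\Lambda}c_t\ell_t=0$ with $c_t\in\mathbb{K}$, put $f_\Lambda=\sum_{j=1}^k c_{i_j}\,y_{i_1}\cdots\widehat{y_{i_j}}\cdots y_{i_k}$. The AOT ideal $I_{\mathcal{A}}$ is the ideal of $S$ generated by all such $f_\Lambda$ together with $y_1^2,\dots,y_d^2$, and the AOT algebra is $S/I_{\mathcal{A}}$ (a standard graded Artinian algebra). Weak Lefschetz Property (WLP): a graded Artinian quotient $A=S/I$ has WLP if there is a linear form $\ell\in S_1$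 such that for all $i$ the multiplication map $\mu_\ell:A_i\to A_{i+1}$, $a\mapsto \ell a$, has maximal rank, i.e. is injective or surjective. $\mathrm{in}_\prec(I)$ denotes the initial ideal of $I$ with respect to the monomial order $\prec$. *)

(* Defs.v *)
From mathcomp Require Import all_boot all_order all_algebra.
From mathcomp Require Export mpoly.

Set Implicit Arguments.
Unset Strict Implicit.
Unset Printing Implicit Defensive.

Import GRing.Theory.
Local Open Scope ring_scope.

Section Ideals.
Variables (K : fieldType) (d : nat).
Local Notation S := {mpoly K[d]}.

(* Ideals of S are Prop-valued predicates on S. *)
Definition ideal_gen (G : S -> Prop) (f : S) : Prop :=
  exists s : seq (S * S),
    (forall ag, ag \in s -> G ag.2) /\ f = \sum_(ag <- s) ag.1 * ag.2.

Definition eq_mod (I : S -> Prop) (f g : S) : Prop := I (f - g).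

(* For a homogeneous ideal I, the component A_i of A = S/I consists of the
   classes modulo I of the forms of degree i; the next two definitions say that
   the map A_i -> A_(i+1) given by multiplication by l is injective, resp.
   surjective. *)
Definition mul_injective (I : S -> Prop) (l : S) (i : nat) : Prop :=
  forall f g : S, f \is i.-homog -> g \is i.-homog ->
    eq_mod I (l * f) (l * g) -> eq_mod I f g.

Definition mul_surjective (I : S -> Prop) (l : S) (i : nat) : Prop :=
  forall g : S, g \is (i.+1).-homog ->
    exists2 f : S, f \is i.-homog & eq_mod I (l * f) g.

Definition WLP (I : S -> Prop) : Prop :=
  exists2 l : S, l \is 1%N.-homog &
    forall i : nat, mul_injective I l i \/ mul_surjective I l i.

Definition monomial_order (le : rel 'X_{1..d}) : Prop :=
  [/\ reflexive le, antisymmetric le, transitive le & total le] /\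
  [/\ forall m : 'X_{1..d}, le 0%MM m &
      forall m m1 m2 : 'X_{1..d}, le m1 m2 -> le (m1 + m)%MM (m2 + m)%MM].

Definition is_leading_monomial (le : rel 'X_{1..d}) (f : S) (m : 'X_{1..d}) :=
  m \in msupp f /\ forall m', m' \in msupp f -> le m' m.

(* The zero polynomial has no leading monomial, so only nonzero f contribute. *)
Definition initial_ideal (le : rel 'X_{1..d}) (I : S -> Prop) : S -> Prop :=
  ideal_gen (fun g => exists f m,
    [/\ I f, is_leading_monomial le f m & g = 'X_[m]]).

End Ideals.

Section OrlikTerao.
Variables (K : fieldType) (n d : nat).

(* The linear forms l_1, ..., l_d in n variables, as linear maps K^n -> K. *)
Variable l : 'I_d -> 'Hom('rV[K]_n, K^o).

Definition hyperplane (i : 'I_d) : {vspace 'rV[K]_n} := lker (l i).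

Definition is_arrangement : Prop :=
  (forall i, l i != 0) /\
  (forall i j, i != j -> ~ exists a : K, l i = a *: l j).

Definition codim_inter (L : {set 'I_d}) : nat :=
  (n - \dim (\bigcap_(i in L) hyperplane i)%VS)%N.

Definition nontrivial_relation (L : {set 'I_d}) (c : 'I_d -> K) : Prop :=
  (exists2 t, t \in L & c t != 0) /\ \sum_(t in L) c t *: l t = 0.

Definition relation_poly (L : {set 'I_d}) (c : 'I_d -> K) : {mpoly K[d]} :=
  \sum_(t in L) c t *: \prod_(s in L :\ t) 'X_s.

Definition aot_generator (g : {mpoly K[d]}) : Prop :=
  (exists (L : {set 'I_d}) (c : 'I_d -> K),
     [/\ (codim_inter L < #|L|)%N, nontrivial_relation L c &
         g = relation_poly L c])
  \/ (exists i : 'I_d, g = 'X_i ^+ 2).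

Definition aot_ideal : {mpoly K[d]} -> Prop := ideal_gen aot_generator.

End OrlikTerao.

(* Main.v *)
Require Import Defs.
From mathcomp Require Import all_boot all_order all_algebra.
From mathcomp Require Import mpoly.
From mathcomp Require Import ring zify.
From HB Require Import structures.

(** The arrangement is the braid arrangement A_3 (the six forms [x_i], [x_i - x_j],
    i, j <= 3) together with the coordinate hyperplane [x_4 = 0]; its AOT algebra is
    B[z]/(z^2), B being the AOT algebra of A_3, with Hilbert function
    (1, 7, 17, 17, 6), and everything happens in the multiplication from degree 2 to
    degree 3.

    For the AOT ideal take the linear form z + m with m = -y_0 + y_1 + ... + y_5:
    since (z + m)(m - z) f = m^2 f, it is enough that [m^2 : B_1 -> B_3] is onto,
    which is checked by explicit certificates.

    Let J be an initial ideal and y the smallest of the variables other than z. Any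
    four of the six forms are dependent, so each cubic monomial in the five other
    variables is in J. For [l = a y + c z + l'], with l' in those five variables,
    this gives [l'^3 = 0] and hence [l f = 0] for
    [f = l'^2 - a l' y - c l' z + 2 a c y z]: the multiplication is not injective
    (special values of l need another f). It is not surjective either: Macaulay's
    argument gives at least six standard monomials [y z w], with w quadratic in the
    five variables, and the five products [l' y_i] cannot span all these w; a linear
    form on the w that vanishes on these products yields one in degree 3 that
    vanishes on the image. *)

Set Implicit Arguments.
Unset Strict Implicit.
Unset Printing Implicit Defensive.

Import GRing.Theory.
Local Open Scope ring_scope.

(** * Ideals, initial ideals and leading monomials *)

Section Ideals.
Variables (K : fieldType) (d : nat).
Local Notation S := {mpoly K[d]}.
Implicit Types (G : S -> Prop) (f g p : S) (m : 'X_{1..d}).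

Lemma ideal_gen_mem G g : G g -> ideal_gen G g.
Proof.
move=> Gg; exists [:: (1, g)]; split=> [ag|]; last by rewrite big_seq1 mul1r.
by rewrite inE => /eqP->.
Qed.

Lemma ideal_gen0 G : ideal_gen G 0.
Proof. by exists [::]; rewrite big_nil. Qed.

Lemma ideal_genD G f g : ideal_gen G f -> ideal_gen G g -> ideal_gen G (f + g).
Proof.
move=> [s [Gs ->]] [t [Gt ->]]; exists (s ++ t); rewrite big_cat; split=> // ag.
by rewrite mem_cat => /orP[/Gs|/Gt].
Qed.

Lemma ideal_genM G p f : ideal_gen G f -> ideal_gen G (p * f).
Proof.
move=> [s [Gs ->]]; exists [seq (p * ag.1, ag.2) | ag <- s].
split=> [_ /mapP[ag /Gs Gag ->] //|].
by rewrite big_map mulr_sumr; apply: eq_bigr => ag _; rewrite mulrA.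
Qed.

Lemma ideal_genMr G p f : ideal_gen G f -> ideal_gen G (f * p).
Proof. by rewrite mulrC; apply: ideal_genM. Qed.

Lemma ideal_genN G f : ideal_gen G f -> ideal_gen G (- f).
Proof. by rewrite -mulN1r; apply: ideal_genM. Qed.

Lemma ideal_genZ G c f : ideal_gen G f -> ideal_gen G (c *: f).
Proof. by rewrite -mul_mpolyC; apply: ideal_genM. Qed.

Lemma ideal_gen_sum G (I : Type) (r : seq I) (P : pred I) (F : I -> S) :
  (forall i, P i -> ideal_gen G (F i)) -> ideal_gen G (\sum_(i <- r | P i) F i).
Proof.
by apply: big_ind => [|f g]; [exact: ideal_gen0 | exact: ideal_genD].
Qed.

Lemma ideal_gen_ind G (P : S -> Prop) :
    P 0 -> (forall f g, P f -> P g -> P (f + g)) ->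
    (forall p g, G g -> P (p * g)) ->
  forall f, ideal_gen G f -> P f.
Proof.
move=> P0 PD PG f [s [Gs ->]]; rewrite big_seq.
by apply: big_ind => // ag /Gs; apply: PG.
Qed.

Section InitialIdeal.
Variables (le : rel 'X_{1..d}) (I : S -> Prop).
Hypothesis leP : monomial_order le.
Hypothesis IM : forall p f, I f -> I (p * f).

Definition leading m : Prop := exists2 f, I f & is_leading_monomial le f m.

Lemma leading_initial m : leading m -> initial_ideal le I 'X_[m].
Proof. by move=> [f If fm]; apply: ideal_gen_mem; exists f, m. Qed.

Lemma leading_mulm m k : leading m -> leading (m + k)%MM.
Proof.
move=> [f If [mf lem]]; exists (f * 'X_[k]); first by rewrite mulrC; apply: IM.
case: leP => _ [_ leD].
split=> [|m']; rewrite (perm_mem (msuppMX f k)).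
  by apply/mapP; exists m; last rewrite addmC.
by move=> /mapP[m1 /lem lem1 ->]; rewrite addmC; apply: leD.
Qed.

Lemma leading_addm m k : leading m -> leading (k + m)%MM.
Proof. by rewrite addmC; apply: leading_mulm. Qed.

(** The generators are monomials, and the leading monomials of [I] are stable under multiplication
    by monomials; so membership in the initial ideal is decided monomial by monomial. *)
Lemma initial_leading g m :
  initial_ideal le I g -> m \in msupp g -> leading m.
Proof.
move=> Jg; move: g Jg m; apply: ideal_gen_ind => [m|f g Pf Pg m|p g].
- by rewrite msupp0.
- by move/msuppD_le; rewrite mem_cat => /orP[/Pf|/Pg].
move=> [f [k [If fk ->]]] m.
rewrite (perm_mem (msuppMX p k)) => /mapP[m1 _ ->].
by apply: leading_mulm; exists f.
Qed.

Lemma initial_coeff g m : initial_ideal le I g -> ~ leading m -> g@_m = 0.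
Proof.
move=> Jg Nm; apply: memN_msupp_eq0; apply/negP => mg.
exact: Nm (initial_leading Jg mg).
Qed.

End InitialIdeal.
End Ideals.

(** * Square-free monomials and linear functionals supported on them *)

Section SquareFree.
Variables (K : fieldType) (d : nat).
Local Notation S := {mpoly K[d]}.
Implicit Types (f g : S) (A B : {set 'I_d}) (m : 'X_{1..d}).

Lemma mesym1D A B : [disjoint A & B] ->
  mesym1 (A :|: B) = (mesym1 A + mesym1 B)%MM.
Proof.
move=> dAB; apply/mnmP => i; rewrite mnmDE !mnmE in_setU.
by case: (boolP (i \in A)) => // iA; rewrite (disjointFr dAB iA).
Qed.

Lemma mesym1U1 i A : i \notin A -> mesym1 (i |: A) = (U_(i) + mesym1 A)%MM.
Proof. by move=> iA; rewrite mesym1D ?mesym1_set1 // disjoints1. Qed.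

Lemma mesym1D1 i A : i \in A -> mesym1 A = (U_(i) + mesym1 (A :\ i))%MM.
Proof. by move=> iA; rewrite -{1}(setD1K iA) mesym1U1 // !inE eqxx. Qed.

Lemma mcoeffXM i f m :
  ('X_i * f)@_m = if (0 < m i)%N then f@_(m - U_(i)) else 0.
Proof.
case: ifP => mi.
  have : (m - U_(i) + U_(i))%MM = m by rewrite submK // lep1mP -lt0n.
  by move: (m - U_(i))%MM => m' <-; rewrite mulrC addmC mcoeffMX.
apply: memN_msupp_eq0; rewrite mulrC (perm_mem (msuppMX f _)); apply/mapP.
by move=> [m' _ mE]; rewrite mE mnmDE mnm1E eqxx in mi.
Qed.

Lemma mcoeffXM_mesym1 i f A :
  ('X_i * f)@_(mesym1 A) = if i \in A then f@_(mesym1 (A :\ i)) else 0.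
Proof.
rewrite mcoeffXM mnmE; case: ifP => [iA|/negbT]; last by case: (i \in A).
have {}iA : i \in A by case: (i \in A) iA.
rewrite iA (mesym1D1 iA); congr (f@_ _).
by apply/mnmP => j; rewrite mnmBE mnmDE addKn.
Qed.

(** Monomials divisible by a square get the value 0, since they lie in every AOT ideal; [phi] lists
    the values on the square-free ones. *)
Definition sqf_form (phi : {set 'I_d} -> K) f : K :=
  \sum_A f@_(mesym1 A) * phi A.

Lemma sqf_formD phi f g : sqf_form phi (f + g) = sqf_form phi f + sqf_form phi g.
Proof. by rewrite -big_split; apply: eq_bigr => A _; rewrite mcoeffD mulrDl. Qed.

Lemma sqf_formZ phi c f : sqf_form phi (c *: f) = c * sqf_form phi f.
Proof. by rewrite mulr_sumr; apply: eq_bigr => A _; rewrite mcoeffZ mulrA. Qed.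

Lemma sqf_form0 phi : sqf_form phi 0 = 0.
Proof. by rewrite -(scale0r 0) sqf_formZ mul0r. Qed.

Lemma sqf_form_sum phi (I : Type) (r : seq I) (P : pred I) (F : I -> S) :
  sqf_form phi (\sum_(i <- r | P i) F i) = \sum_(i <- r | P i) sqf_form phi (F i).
Proof. by apply: big_morph => [f g|]; [exact: sqf_formD | exact: sqf_form0]. Qed.

Lemma sqf_formX phi A : sqf_form phi 'X_[mesym1 A] = phi A.
Proof.
rewrite /sqf_form (bigD1 A) //= mcoeffX eqxx mul1r big1 ?addr0 // => B nBA.
by rewrite mcoeffX (inj_eq (@inj_mesym1 _)) eq_sym (negbTE nBA) mul0r.
Qed.

Lemma sqf_formX_nsqf phi m i : (1 < m i)%N -> sqf_form phi 'X_[m] = 0.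
Proof.
move=> mi; rewrite /sqf_form big1 // => A _; rewrite mcoeffX.
case: eqP => [mE|]; last by rewrite mul0r.
by move: mi; rewrite mE mnmE; case: (i \in A).
Qed.

Lemma mesym1_supp m : (forall i, m i <= 1)%N -> m = mesym1 [set i | (0 < m i)%N].
Proof.
by move=> m1; apply/mnmP => i; rewrite mnmE inE; case: (m i) (m1 i) => [|[]].
Qed.

End SquareFree.

Lemma prod_mpolyX (K : fieldType) d (A : {set 'I_d}) :
  \prod_(i in A) 'X_i = 'X_[mesym1 A] :> {mpoly K[d]}.
Proof.
rewrite -(big_morph (fun m => 'X_[m]) (@mpolyXD _ _) (@mpolyX0 _ _)).
congr 'X_[_]; apply/mnmP => i; rewrite mnm_sumE mnmE.
rewrite (eq_bigr (fun j => (i == j) : nat)) => [|j _]; last by rewrite mnm1E eq_sym.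
rewrite -big_mkcondr /= sum1dep_card.
case: (boolP (i \in A)) => iA.
  rewrite -[RHS](cards1 i); apply: eq_card => j; rewrite !inE eq_sym andbC.
  by case: eqP => // ->.
apply: eq_card0 => j; rewrite !inE; apply/negP => /andP[jA /eqP ij].
by rewrite ij jA in iA.
Qed.

(** * Functionals vanishing on the AOT ideal; the codimension condition *)

Section Arrangement.
Variables (K : fieldType) (n d : nat) (l : 'I_d -> 'Hom('rV[K]_n, K^o)).
Implicit Types (L T U : {set 'I_d}).

Lemma relation_polyE L (c : 'I_d -> K) :
  relation_poly L c = \sum_(t in L) c t *: 'X_[mesym1 (L :\ t)].
Proof. by apply: eq_bigr => t _; rewrite prod_mpolyX. Qed.

(* A relation [c] among the forms is orthogonal to the values [l t x] for every
   point [x]; the first condition deals with the products [X_T * f_L], L and T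
   disjoint (with U = L + T), the second one with the case where they share [t0]. *)
Lemma sqf_form_aot (phi : {set 'I_d} -> K) :
    (forall U, exists x, forall t, t \in U -> l t x = phi (U :\ t)) ->
    (forall U t0, t0 \in U -> exists x,
      l t0 x = phi U /\ forall t, t \in U -> t != t0 -> l t x = 0) ->
  forall f, aot_ideal l f -> sqf_form phi f = 0.
Proof.
move=> phi1 phi2; apply: ideal_gen_ind => [|f g f0 g0|p g].
- exact: sqf_form0.
- by rewrite sqf_formD f0 g0 addr0.
rewrite [p]mpolyE mulr_suml sqf_form_sum => Gg; apply: big1_seq => m _.
rewrite -scalerAl sqf_formZ.
suff -> : sqf_form phi ('X_[m] * g) = 0 by rewrite mulr0.
case: Gg => [[L [c [_ [_ relc] ->]]]|[i ->]]; last first.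
  rewrite mpolyXn -mpolyXD; apply: (@sqf_formX_nsqf _ _ _ _ i).
  by rewrite mnmDE mulmnE mnm1E eqxx; lia.
have relx x : \sum_(t in L) c t * l t x = 0.
  have /= := congr1 (fun f : 'Hom(_, _) => f x) relc.
  rewrite sum_lfunE zero_lfunE; apply: etrans.
  by apply: eq_bigr => t _; rewrite scale_lfunE.
rewrite relation_polyE mulr_sumr sqf_form_sum.
under eq_bigr => t _ do rewrite -scalerAr sqf_formZ -mpolyXD.
(* A square in the multiplier survives in every term; otherwise the multiplier is the square-free
   monomial of a set [T]. *)
have [/forallP m1|] := boolP [forall i, (m i <= 1)%N]; last first.
  rewrite negb_forall => /existsP[i]; rewrite -ltnNge => mi.
  apply: big1 => t _; rewrite (@sqf_formX_nsqf _ _ _ _ i) ?mulr0 // mnmDE.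
  exact: leq_trans mi (leq_addr _ _).
rewrite (mesym1_supp m1); move: [set i | _] => T.
have [dis|] := boolP [disjoint T & L].
  have [x xE] := phi1 (T :|: L); apply: etrans (relx x); apply: eq_bigr => t tL.
  have tT : t \notin T by rewrite (disjointFl dis tL).
  rewrite -mesym1D ?sqf_formX; last first.
    by apply: disjointWr dis; apply: subsetDl.
  rewrite xE ?inE ?tL ?orbT //; congr (_ * phi _).
  by apply/setP => i; rewrite !inE; case: eqP => //= ->; rewrite (negbTE tT).
rewrite -setI_eq0 => /set0Pn[t0 /setIP[t0T t0L]].
have [x [xt0 x0]] := phi2 (T :|: L) t0 (subsetP (subsetUr T L) _ t0L).
have nsq t : t \in L -> t != t0 ->
    sqf_form phi 'X_[mesym1 T + mesym1 (L :\ t)] = 0.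
  move=> tL tt0; apply: (@sqf_formX_nsqf _ _ _ _ t0).
  by rewrite mnmDE !mnmE t0T !inE t0L eq_sym tt0.
have ct0 : c t0 * phi (T :|: L) = 0.
  rewrite -[RHS](relx x) (bigD1 t0) //= xt0 big1 ?addr0 // => t /andP[tL tt0].
  by rewrite x0 ?mulr0 // inE tL orbT.
rewrite (bigD1 t0) //= big1 ?addr0 => [|t /andP[tL tt0]]; last first.
  by rewrite nsq ?mulr0.
(* If [t0] is the only index shared by [T] and [L], the remaining term is the monomial of [T :|: L];
   a second shared index puts a square into it as well. *)
have [dis|] := boolP [disjoint T & L :\ t0].
  rewrite -mesym1D // sqf_formX -[RHS]ct0; congr (_ * phi _); apply/setP => i.
  by rewrite !inE; case: (eqVneq i t0) => //= ->; rewrite t0T.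
rewrite -setI_eq0 => /set0Pn[i /setIP[iT iL]].
rewrite (@sqf_formX_nsqf _ _ _ _ i) ?mulr0 // mnmDE !mnmE iT.
by rewrite iL.
Qed.

Lemma codim_inter_lt_card L c :
  nontrivial_relation l L c -> (codim_inter l L < #|L|)%N.
Proof.
move=> [[t tL ct] relc].
have codim_le T : (n <= \dim (\bigcap_(i in T) hyperplane l i)%VS + #|T|)%N.
  have [k] := ubnP #|T|; elim: k T => // k IHk T; rewrite ltnS => leTk.
  have [->|/set0Pn[i iT]] := eqVneq T set0.
    by rewrite big_set0 dimvf /dim /= mul1n leq_addr.
  have /IHk : (#|T :\ i| < k)%N by move: leTk; rewrite (cardsD1 i) iT.
  rewrite (big_setD1 i iT) /= capvC (cardsD1 i T) iT.
  set V := (\bigcap_(j in _) _)%VS.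
  have := limg_ker_dim (l i) V; rewrite -/(hyperplane l i).
  have : (\dim (l i @: V) <= 1)%N by rewrite (leq_trans (dimvS (subvf _))) // dimvf.
  move=> le1 <- /leq_trans; apply.
  by rewrite -addnA leq_add2l leq_add2r.
rewrite /codim_inter.
have -> : (\bigcap_(i in L) hyperplane l i = \bigcap_(i in L :\ t) hyperplane l i)%VS.
  rewrite (big_setD1 t tL) /=; apply/capv_idPr/subvP => x.
  move=> xL; have xker i : i \in L :\ t -> l i x = 0.
    move=> iL; apply/eqP; rewrite -memv_ker.
    have /subvP -> // : (\bigcap_(j in L :\ t) hyperplane l j <= lker (l i))%VS.
    by rewrite (bigD1 i) //= capvSl.
  rewrite memv_ker; apply/eqP/(mulfI ct); rewrite mulr0.
  have /= := congr1 (fun f : 'Hom(_, _) => f x) relc.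
  rewrite sum_lfunE zero_lfunE (big_setD1 t tL) /= big1 ?addr0 ?scale_lfunE // => i iL.
  by rewrite scale_lfunE xker // scaler0.
by rewrite (cardsD1 t L) tL ltnS leq_subLR.
Qed.

End Arrangement.

(** * Linear dependence and leading monomials of the AOT ideal *)

Lemma dependent_rows (K : fieldType) (T I : finType) (W : {set T}) (D : {set I})
    (M : T -> I -> K) : (#|D| < #|W|)%N ->
  exists2 c : T -> K, exists2 t, t \in W & c t != 0 &
    forall i, i \in D -> \sum_(t in W) c t * M t i = 0.
Proof.
move=> ltDW; pose A := \matrix_(a < #|W|, b < #|D|) M (enum_val a) (enum_val b).
have /rowV0Pn[v /sub_kermxP vA0 v0] : kermx A != 0.
  by rewrite -mxrank_eq0 mxrank_ker subn_eq0 -ltnNge (leq_ltn_trans (rank_leq_col A)).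
have [a va] : exists a, v 0 a != 0 by apply/rV0Pn.
have W0 : enum_val a \in W := enum_valP a.
pose c t := v 0 (enum_rank_in W0 t); exists c => [|i iD].
  by exists (enum_val a); rewrite ?enum_valP // /c enum_valK_in.
rewrite big_enum_val /=; have := congr1 (fun B : 'rV_ _ => B 0 (enum_rank_in iD i)) vA0.
rewrite !mxE; apply: etrans; apply: eq_bigr => b _.
by rewrite /c enum_valK_in !mxE enum_rankK_in.
Qed.

Section MonomialOrder.
Variables (K : fieldType) (n d : nat) (l : 'I_d -> 'Hom('rV[K]_n, K^o)).
Variable le : rel 'X_{1..d}.
Hypothesis leP : monomial_order le.
Implicit Types (A B L S : {set 'I_d}).
Local Notation lead := (leading le (aot_ideal l)).

Lemma leading_subset A B : A \subset B -> lead (mesym1 A) -> lead (mesym1 B).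
Proof.
move=> AB; have -> : mesym1 B = (mesym1 A + mesym1 (B :\: A))%MM.
  rewrite -mesym1D; first by rewrite -{1}(setIidPr AB) setID.
  by rewrite -setI_eq0 setIDA setIC -setIDA setDv setI0.
by apply: leading_mulm => // p f; apply: ideal_genM.
Qed.

Lemma min_variable L t0 : t0 \in L ->
  exists2 t, t \in L & forall s, s \in L -> le U_(t)%MM U_(s)%MM.
Proof.
case: leP => [[lexx _ letr letot] _] t0L.
have [t tL tmin] := @extremumP _ _ le t0 (mem L) (fun i => U_(i)%MM) lexx letr letot t0L.
by exists t.
Qed.

(** Each term of [relation_poly L c] is the product of the variables in [L] with one factor removed,
    so removing the smallest variable leaves the largest monomial. *)
Lemma leading_relation L (c : 'I_d -> K) t0 :
    (forall t, t \in L -> c t != 0) -> \sum_(t in L) c t *: l t = 0 ->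
    t0 \in L -> (forall t, t \in L -> le U_(t0)%MM U_(t)%MM) ->
  lead (mesym1 (L :\ t0)).
Proof.
case: leP => [[lexx _ letr letot] [_ leD]] c0 relc t0L t0min.
have ntc : nontrivial_relation l L c by split=> //; exists t0; rewrite ?c0.
exists (relation_poly L c).
  by apply: ideal_gen_mem; left; exists L, c; split=> //; apply: codim_inter_lt_card ntc.
have D1_inj t s : t \in L -> L :\ t = L :\ s -> t = s.
  by move=> tL /setP/(_ t); rewrite !inE eqxx tL /= andbT => /esym/negbFE/eqP.
rewrite relation_polyE; split=> [|m].
  rewrite mcoeff_msupp raddf_sum (bigD1 t0) //= mcoeffZ mcoeffX eqxx mulr1 big1.
    by rewrite addr0 c0.
  move=> t /andP[tL tt0]; rewrite mcoeffZ mcoeffX (inj_eq (@inj_mesym1 _)).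
  case: eqP => [/(D1_inj _ _ tL) tE|]; last by rewrite mulr0.
  by rewrite tE eqxx in tt0.
have [/existsP[t /andP[tL /eqP->]] _|] := boolP [exists t in L, m == mesym1 (L :\ t)].
  have [-> //|tt0] := eqVneq t t0.
  (* The two monomials share all factors except one, so comparing them reduces to comparing the
     variables of [t0] and [t]. *)
  rewrite (@mesym1D1 _ t0 (L :\ t)) ?inE ?t0L ?[t0 == t]eq_sym ?tt0 //.
  rewrite (@mesym1D1 _ t (L :\ t0)) ?inE ?tL ?tt0 //.
  by rewrite !setDDl [[set t0; t]]setUC leD ?t0min.
rewrite negb_exists => /forallP nm; rewrite mcoeff_msupp raddf_sum big1 ?eqxx // => t tL.
rewrite /= mcoeffZ mcoeffX; have := nm t; rewrite tL /= eq_sym => /negbTE->.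
by rewrite mulr0.
Qed.

(** The forms in [S] lie in the span of fewer than [#|S|] vectors, so a relation with nonzero
    coefficients holds on some subset [L] of [S]. If [L] contains [t0], remove [t0] from it; if not,
    [L] already lies in [S :\ t0] and its own smallest variable is removed. *)
Lemma leading_rank (I : finType) (D : {set I}) (h : I -> 'Hom('rV[K]_n, K^o))
    (M : 'I_d -> I -> K) S t0 :
    (forall t, t \in S -> l t = \sum_(i in D) M t i *: h i) ->
    (#|D| < #|S|)%N -> t0 \in S ->
    (forall t, t \in S -> le U_(t0)%MM U_(t)%MM) ->
  lead (mesym1 (S :\ t0)).
Proof.
move=> lE /(dependent_rows M)[c [s sS cs] cM] t0S t0min.
pose L := [set t in S | c t != 0].
have sL : s \in L by rewrite inE sS.
have c0 t : t \in L -> c t != 0 by rewrite inE => /andP[].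
have LS : L \subset S by apply/subsetP => t; rewrite inE => /andP[].
have relc : \sum_(t in L) c t *: l t = 0.
  transitivity (\sum_(t in S) c t *: l t).
    rewrite [RHS](big_setID L) /= (setIidPr LS) [X in _ + X]big1 ?addr0 // => t.
    by rewrite !inE => /andP[] /[swap] -> /=; rewrite negbK => /eqP->; rewrite scale0r.
  rewrite (eq_bigr _ (fun t tS => congr1 _ (lE t tS))).
  under eq_bigr do rewrite scaler_sumr.
  rewrite exchange_big big1 // => i iD.
  by under eq_bigr do rewrite scalerA; rewrite -scaler_suml cM ?scale0r.
have [t0L|t0L] := boolP (t0 \in L).
  apply: leading_subset (leading_relation c0 relc t0L _); first exact: setSD.
  by move=> t /(subsetP LS); apply: t0min.
have [t tL tmin] := min_variable sL.
apply: leading_subset (leading_relation c0 relc tL tmin).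
by rewrite subsetD1 (subset_trans (subsetDl _ _) LS) in_setD1 negb_and t0L orbT.
Qed.

(* Macaulay's argument: the square-free monomials whose image under [v] is not
   spanned by the images of smaller ones are standard, and their images already
   span everything. *)
Lemma standard_set r (v : {set 'I_d} -> 'rV[K]_r) :
    (forall f, aot_ideal l f -> \sum_A f@_(mesym1 A) *: v A = 0) ->
    (forall k, exists A, v A = delta_mx 0 k) ->
  exists W : {set {set 'I_d}}, [/\ (r <= #|W|)%N,
    forall A, A \in W -> v A != 0 & forall A, A \in W -> ~ lead (mesym1 A)].
Proof.
case: leP => [[lexx leanti letr letot] _] vI vfull.
pose lt B A := le (mesym1 B) (mesym1 A) && (B != A).
have lt_trans B A C : lt B A -> lt C B -> lt C A.
  move=> /andP[leBA BA] /andP[leCB CB]; rewrite /lt (letr _ _ _ leCB leBA) /=.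
  apply: contraNneq BA => CA; rewrite -CA in leBA *.
  by apply/eqP/(@inj_mesym1 d)/leanti; rewrite leBA leCB.
pose V A := <<[seq v B | B <- enum [set B | lt B A]]>>%VS.
have memV A B : lt B A -> v B \in V A.
  by move=> ltBA; apply/memv_span/map_f; rewrite mem_enum inE.
pose W := [set A | v A \notin V A].
(* Induction on the number of smaller square-free monomials. *)
have vW A : v A \in <<[seq v B | B <- enum W]>>%VS.
  have [k] := ubnP #|[set B | lt B A]|; elim: k A => // k IHk A ltAk.
  have [AW|] := boolP (A \in W); first by apply/memv_span/map_f; rewrite mem_enum.
  rewrite inE negbK; apply/subvP/span_subvP => _ /mapP[B + ->].
  rewrite mem_enum inE => ltBA; apply: IHk; apply: (leq_trans _ (ltAk : (_ <= k)%N)).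
  rewrite ltnNge; apply/negP => le_card.
  have sub : [set C | lt C B] \subset [set C | lt C A].
    by apply/subsetP => C; rewrite !inE; apply: lt_trans.
  have /setP/(_ B) : [set C | lt C B] = [set C | lt C A].
    by apply/eqP; rewrite eqEcard sub.
  by rewrite !inE ltBA /lt eqxx andbF.
exists W; split.
- rewrite cardE -(size_map v); apply: leq_trans _ (dim_span _).
  suff -> : <<[seq v B | B <- enum W]>>%VS = fullv by rewrite dimvf /dim /= mul1n.
  apply/vspaceP => x; rewrite memvf.
  rewrite [x]row_sum_delta; apply: memv_suml => k _; apply: memvZ.
  by have [A <-] := vfull k.
- by move=> A; rewrite inE; apply: contraNneq => ->; apply: mem0v.
(* If the monomial of [A] led some [f] in the ideal, applying [v] to [f] and dividing by the leading
   coefficient would express [v A] through smaller monomials. *)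
move=> A; rewrite inE => /negP AV [f If [mf lef]]; apply: AV.
rewrite mcoeff_msupp in mf; have := vI f If; rewrite (bigD1 A) //=.
move=> /eqP; rewrite addr_eq0 => /eqP/(congr1 (fun x => (f@_(mesym1 A))^-1 *: x)).
rewrite scalerA mulVf // scale1r => ->.
apply: memvZ; rewrite memvN; apply: memv_suml => B BA.
have [->|fB] := eqVneq f@_(mesym1 B) 0; first by rewrite scale0r mem0v.
by apply/memvZ/memV; rewrite /lt BA lef // mcoeff_msupp.
Qed.

End MonomialOrder.

(** * Linear forms and the square-free coefficients of their products *)

Section LinearForms.
Variables (K : fieldType) (d : nat).
Implicit Types (a b : 'I_d -> K) (A : {set 'I_d}) (f : {mpoly K[d]}).

Definition lin a : {mpoly K[d]} := \sum_i a i *: 'X_i.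

Lemma homog_lin a : lin a \is 1.-homog.
Proof. by apply: rpred_sum => i _; apply: rpredZ; rewrite dhomogX /= mdeg1. Qed.

Lemma homog1_lin f : f \is 1.-homog -> f = lin (fun i => f@_(U_(i))).
Proof.
move=> /dhomogP f1; apply/mpolyP => m; rewrite raddf_sum /=.
under eq_bigr do rewrite mcoeffZ mcoeffX.
have [/eqP/mdeg1P[i /eqP ->]|m1] := eqVneq (mdeg m) 1%N.
  rewrite (bigD1 i) //= eqxx mulr1 big1 ?addr0 // => j ji.
  by rewrite eq_mnm1 ?(negbTE ji) ?mulr0.
have -> : f@_m = 0.
  by apply: memN_msupp_eq0; apply: contraNN m1 => /f1 E; apply/eqP.
rewrite big1 // => i _; case: eqP => [E|_]; last by rewrite mulr0.
by rewrite -E mdeg1 eqxx in m1.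

Qed.

Lemma mcoeff_linM a f A :
  (lin a * f)@_(mesym1 A) = \sum_(i in A) a i * f@_(mesym1 (A :\ i)).
Proof.
rewrite mulr_suml raddf_sum [RHS]big_mkcond /=; apply: eq_bigr => i _.
by rewrite -scalerAl mcoeffZ mcoeffXM_mesym1; case: ifP; rewrite ?mulr0.
Qed.

Lemma mcoeff_lin a i : (lin a)@_(mesym1 [set i]) = a i.
Proof.
rewrite -[lin a]mulr1 mcoeff_linM big_set1 setDv mesym1_set0.
by rewrite mcoeff1 eqxx mulr1.
Qed.

Lemma mcoeff_linM2 a b i j : i != j ->
  (lin a * lin b)@_(mesym1 [set i; j]) = a i * b j + a j * b i.
Proof.
move=> ij; rewrite mcoeff_linM big_setU1 ?inE //= big_set1.
have -> : [set i; j] :\ i = [set j] by rewrite setU1K // inE.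
by rewrite [[set i; j]]setUC setU1K ?mcoeff_lin // inE eq_sym.
Qed.

End LinearForms.

(** * A criterion for an initial ideal to fail the Weak Lefschetz Property in degree 2 *)

Section NotWLP.
Variables (K : fieldType) (d : nat) (I : {mpoly K[d]} -> Prop).
Variables (le : rel 'X_{1..d}) (leP : monomial_order le).
Hypothesis IM : forall p f : {mpoly K[d]}, I f -> I (p * f).
Hypothesis two_neq0 : 2 != 0 :> K.
Local Notation lead := (leading le I).
Local Notation J := (initial_ideal le I).
Variables (y z : 'I_d) (W : {set {set 'I_d}}).
Local Notation D := (~: [set y; z]).
Hypothesis yz : y != z.
Hypothesis lead_square : forall i, lead (U_(i) + U_(i))%MM.
Hypothesis lead_cubic : forall T : {set 'I_d},
  T \subset D -> (2 < #|T|)%N -> lead (mesym1 T).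
Hypothesis std_pair : forall i, i != z -> ~ lead (mesym1 [set i; z]).
Hypothesis ltDW : (#|D| < #|W|)%N.
Hypothesis std_quartic : forall A, A \in W -> #|A| = 4 /\ ~ lead (mesym1 A).

Let JX m : lead m -> J 'X_[m]. Proof. exact: leading_initial. Qed.

Let Jsq i : J ('X_i * 'X_i).
Proof. by rewrite -mpolyXD; apply: JX. Qed.

Let Jcubic i j k : i \in D -> j \in D -> k \in D -> J ('X_i * 'X_j * 'X_k).
Proof.
move=> iD jD kD.
have [<-|ij] := eqVneq i j; first exact: ideal_genMr (Jsq i).
have [<-|ik] := eqVneq i k; first by rewrite mulrAC; apply: ideal_genMr (Jsq i).
have [<-|jk] := eqVneq j k; first by rewrite -mulrA; apply: ideal_genM (Jsq j).
have -> : 'X_i * 'X_j * 'X_k = 'X_[mesym1 (i |: (j |: [set k]))] :> {mpoly K[d]}.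
  by rewrite !mesym1U1 ?inE ?negb_or ?ij ?ik // mesym1_set1 !mpolyXD mulrA.
apply/JX/lead_cubic; first by rewrite !subUset !sub1set iD jD kD.
by rewrite !cardsU1 cards1 !inE negb_or ij ik jk.
Qed.

(** By [lead_cubic] a square-free standard monomial has at most two factors from [D]; with four
    factors in all it must contain both [y] and [z]. *)
Let std_quarticE A : A \in W -> exists i j,
  [/\ i != j, i \in D, j \in D & A = y |: (z |: [set i; j])].
Proof.
move=> /std_quartic[A4 stdA].
have AD : (#|A :&: D| <= 2)%N.
  rewrite leqNgt; apply/negP => /(lead_cubic (subsetIr A D)) leadAD; apply: stdA.
  rewrite -(setID A D) mesym1D; first exact: leading_mulm.
  rewrite -setI_eq0; apply/eqP/setP => k; rewrite !in_setI in_setD in_set0.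
  by case: (k \in D); rewrite ?andbF.
have := cardsID D A; rewrite A4 setDE setCK => cardA.
have ADc : (#|A :&: [set y; z]| <= 2)%N.
  by rewrite (leq_trans (subset_leq_card (subsetIr _ _))) // cards2; case: eqP.
have [AD2 ADc2] : #|A :&: D| = 2%N /\ #|A :&: [set y; z]| = 2%N.
  by move: AD ADc cardA; case: #|_| => [|[|[]]] //; case: #|_| => [|[|[]]].
have /cards2P[i [j [ij AE]]] : #|A :&: D| == 2%N by rewrite AD2.
have yzA : A :&: [set y; z] = [set y; z].
  by apply/eqP; rewrite eqEcard subsetIr cards2 yz ADc2.
exists i, j; split=> //.
- by have /setIP[] : i \in A :&: D by rewrite AE set21.
- by have /setIP[] : j \in A :&: D by rewrite AE set22.
by rewrite setUA -AE -{1}(setID A D) setUC setDE setCK yzA.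
Qed.

Section Multiplication.
Variable a : 'I_d -> K.
Local Notation Y := ('X_y : {mpoly K[d]}).
Local Notation Z := ('X_z : {mpoly K[d]}).

Let lin_split (b : 'I_d -> K) :
  lin b = (b y)%:MP * Y + (b z)%:MP * Z + \sum_(i in D) b i *: 'X_i.
Proof.
rewrite /lin (bigD1 y) //= (bigD1 z) 1?eq_sym //= addrA !mul_mpolyC.
by congr (_ + _); apply: eq_bigl => i; rewrite !inE negb_or.
Qed.

(** Allows the factors of the kernel elements below to be written as [lin b], so that [mcoeff_linM2]
    gives their coefficients. *)
Let lin_lD (c1 c2 : K) : exists b : 'I_d -> K,
  [/\ lin b = c1%:MP * Y + c2%:MP * Z + \sum_(i in D) a i *: 'X_i,
      b y = c1, b z = c2 & forall i, i \in D -> b i = a i].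
Proof.
exists (fun i => if i == y then c1 else if i == z then c2 else a i).
rewrite !eqxx [z == y]eq_sym (negbTE yz); split=> // [|i].
  rewrite lin_split !eqxx [z == y]eq_sym (negbTE yz); congr (_ + _).
  by apply: eq_bigr => i; rewrite !inE negb_or => /andP[/negbTE-> /negbTE->].
by rewrite !inE negb_or => /andP[/negbTE-> /negbTE->].
Qed.

(** Injectivity would put every quadratic form killed by [lin a] into [J], where the coefficient at
    each standard monomial y_i z is 0. The form [f1] then gives [a z * a i = 0] for [i != z]; if
    [a z = 0], the form [Z * lin b2] gives [a i = 0]; and once only [a z] can be nonzero, [Y * Z] is
    killed although it is standard. *)
Lemma not_mul_injective2 : ~ mul_injective J (lin a) 2.
Proof.
move=> inj.
have J0 f : f \is 2.-homog -> J (lin a * f) -> J f.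
  move=> f2 Jf; rewrite -[f]subr0; apply: inj => //; first exact: dhomog0.
  by rewrite /eq_mod mulr0 subr0.
have coef0 f i : J f -> i != z -> f@_(mesym1 [set i; z]) = 0.
  by move=> Jf iz; apply: (initial_coeff leP IM Jf); apply: std_pair.
have homog2 (b b' : 'I_d -> K) : lin b * lin b' \is 2.-homog.
  by rewrite -[2%N]/(1 + 1)%N; apply: dhomogM; apply: homog_lin.
have homogYZ : Y * Z \is 2.-homog by rewrite -mpolyXD dhomogX /= mdegD !mdeg1.
set L := \sum_(i in D) a i *: 'X_i : {mpoly K[d]}.
have linE : lin a = (a y)%:MP * Y + (a z)%:MP * Z + L := lin_split a.
have JL3 : J (L * L * L).
  rewrite /L !mulr_suml; apply: ideal_gen_sum => i iD.
  rewrite mulr_sumr; apply: ideal_gen_sum => k kD.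
  rewrite mulr_sumr mulr_suml; apply: ideal_gen_sum => j jD.
  rewrite -!(scalerAl, scalerAr); do 3!apply: ideal_genZ; exact: Jcubic.
(* With [L] the part of [lin a] in the variables of [D]: [lin b] is L - a_y Y - a_z Z, [lin a'] is
   L, and [lin b2] is L - 2 a_y Y. *)
have [b [bE by_ bz bD]] := lin_lD (- a y) (- a z).
have [a' [a'E a'y a'z a'D]] := lin_lD 0 0.
have [b2 [b2E b2y b2z b2D]] := lin_lD (- (2 * a y)) 0.
rewrite -/L in bE a'E b2E.
rewrite !mpolyC0 !mul0r !add0r in a'E.
rewrite mpolyC0 mul0r addr0 in b2E.
pose f1 := lin a' * lin b + (2 * a y * a z) *: (Y * Z).
have Jf1 : J f1.
  apply: J0; first by apply: rpredD (homog2 _ _) _; apply: rpredZ homogYZ.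
  have -> : lin a * f1 = L * L * L
      + ((a y)%:MP ^+ 2 * (2 * (a z)%:MP * Z - L)) * (Y * Y)
      + ((a z)%:MP ^+ 2 * (2 * (a y)%:MP * Y - L)) * (Z * Z).
    rewrite /f1 a'E bE linE -mul_mpolyC !mpolyCN !mpolyCM.
    have -> : 2%:MP_[d] = 2 :> {mpoly K[d]} by rewrite mpolyC_nat.
    ring.
  apply: ideal_genD (ideal_genM _ (Jsq z)).
  exact: ideal_genD JL3 (ideal_genM _ (Jsq y)).
have f1E i : i != z -> a z * a i = 0.
  move=> iz; have := coef0 _ i Jf1 iz; rewrite mcoeffD mcoeffZ mcoeff_linM2 //.
  rewrite a'z mul0r addr0 bz -mpolyXD -(mesym1_set1 z) -mesym1U1 ?inE //.
  rewrite mcoeffX (inj_eq (@inj_mesym1 _)).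
  have [->|iy] := eqVneq i y.
    rewrite eqxx a'y mul0r add0r mulr1 -mulrA => /eqP.
    by rewrite mulf_eq0 (negbTE two_neq0) mulrC => /eqP.
  rewrite a'D ?inE ?negb_or ?iy ?iz //; case: eqP => [/setP/(_ i)|_].
    by rewrite !inE eqxx (negbTE iy) (negbTE iz).
  by rewrite mulr0 addr0 mulrN => /eqP; rewrite oppr_eq0 mulrC => /eqP.
have a0 i : i != z -> a i = 0.
  have [az0 iz|az0 /f1E/eqP] := eqVneq (a z) 0; last first.
    by rewrite mulf_eq0 (negbTE az0) => /eqP.
  have : J (Z * lin b2).
    apply: J0.
      by rewrite -[2%N]/(1 + 1)%N dhomogM ?homog_lin // dhomogX /= mdeg1.
    have -> : lin a * (Z * lin b2) = Z * f1 + (- 2 * (a y)%:MP ^+ 2 * Z) * (Y * Y).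
      rewrite /f1 az0 mulr0 scale0r addr0 a'E bE linE b2E az0.
      rewrite !(mpolyCN, mpolyCM, mpolyC0, oppr0).
      have -> : 2%:MP_[d] = 2 :> {mpoly K[d]} by rewrite mpolyC_nat.
      ring.
    exact: ideal_genD (ideal_genM _ Jf1) (ideal_genM _ (Jsq y)).
  move/coef0 => /(_ i iz); rewrite mcoeffXM_mesym1 !inE eqxx orbT.
  rewrite [[set i; z]]setUC setU1K ?inE 1?eq_sym // mcoeff_lin.
  have [->|iy] := eqVneq i y; last by rewrite b2D // !inE negb_or iy.
  rewrite b2y => /eqP; rewrite oppr_eq0 mulf_eq0 (negbTE two_neq0) /=.
  by move/eqP.
have /coef0/(_ yz) : J (Y * Z).
  apply: J0 => //; rewrite linE a0 // /L big1 => [|i].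
    rewrite mpolyC0 mul0r add0r addr0.
    have -> : (a z)%:MP * Z * (Y * Z) = (a z)%:MP * Y * (Z * Z) by ring.
    exact: ideal_genM (Jsq z).
  by rewrite !inE negb_or => /andP[_ /a0 ->]; rewrite scale0r.
rewrite -mpolyXD -(mesym1_set1 z) -mesym1U1 ?inE // mcoeffX eqxx.
by move/eqP; rewrite oner_eq0.
Qed.

Lemma not_mul_surjective2 : ~ mul_surjective J (lin a) 2.
Proof.
(* For A = {y, z, i, j}, the entry [M A i] is [a j], the coefficient of w = y_i y_j in l' y_i, where
   l' is the part of [lin a] in the variables of [D]. So [theta] is a nonzero linear form on the w
   that vanishes on all products l' y_i. *)
pose M (A : {set 'I_d}) i := if i \in A then \sum_(k in A :&: D | k != i) a k else 0.
have [theta [B BW thB] thM] := dependent_rows M ltDW.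
(* A nonzero vector orthogonal to [(a y, a z)]; it will cancel what [a y] and [a z] contribute to
   [F (lin a * f)]. *)
have [p [q [pq0 pq]]] : exists p q, p * a y + q * a z = 0 /\ ((p != 0) || (q != 0)).
  have [az0|az] := eqVneq (a z) 0; last first.
    by exists (a z), (- a y); rewrite az; split=> //; ring.
  have [ay0|ay] := eqVneq (a y) 0; last first.
    by exists 0, 1; rewrite az0 mul0r mulr0 addr0 oner_eq0 orbT.
  by exists 1, 0; rewrite ay0 mul0r mulr0 addr0 oner_eq0.
have lin_comb ay az ai aj e yi yj zi zj : p * ay + q * az = 0 ->
    p * (ay * e + ai * yj + aj * yi) + q * (az * e + ai * zj + aj * zi)
    = aj * (p * yi + q * zi) + ai * (p * yj + q * zj).
  by move=> pq0'; rewrite -[RHS]add0r -(mul0r e) -pq0'; ring.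
(* For A = y z w, the sets [A :\ z] and [A :\ y] stand for y w and z w: [F] extends [theta] to
   degree 3, weighting these two by [p] and [q]. *)
pose F (f : {mpoly K[d]}) := \sum_(A in W)
  theta A * (p * f@_(mesym1 (A :\ z)) + q * f@_(mesym1 (A :\ y))).
have FD f g : F (f - g) = F f - F g.
  by rewrite -sumrB; apply: eq_bigr => A _; rewrite !mcoeffB; ring.
have std_sub A i : A \in W -> i \in A -> ~ lead (mesym1 (A :\ i)).
  by move=> /std_quartic[_ +] iA leadA; apply; rewrite (mesym1D1 iA); apply: leading_addm.
have yzD i : i \in D -> (i == y = false) * (i == z = false).
  by rewrite !inE negb_or => /andP[/negbTE-> /negbTE->].
have FJ f : J f -> F f = 0.
  move=> Jf; rewrite /F big1 // => A AW; have [i [j [_ _ _ AE]]] := std_quarticE AW.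
  by rewrite !(initial_coeff leP IM Jf) ?mulr0 ?addr0 ?mulr0 //; apply: std_sub;
    rewrite // AE !inE eqxx ?orbT.
(* In each summand [lin_comb] removes the coefficient of [f] at w; what remains is a row of [M]
   applied to [G], and [theta] annihilates the rows. *)
have Flin f : F (lin a * f) = 0.
  pose G i := p * f@_(mesym1 [set y; i]) + q * f@_(mesym1 [set z; i]).
  transitivity (\sum_(A in W) theta A * \sum_(i in D) M A i * G i); last first.
    under eq_bigr do rewrite mulr_sumr.
    rewrite exchange_big big1 // => i iD.
    by under eq_bigr do rewrite mulrA; rewrite -mulr_suml thM ?mul0r.
  apply: eq_bigr => A AW; congr (_ * _).
  have [i [j [ij iD jD AE]]] := std_quarticE AW.
  have AD : A :&: D = [set i; j].
    apply/setP => k; rewrite AE in_setI !in_setU !in_set1 in_setC in_set2.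
    by case: (eqVneq k i) => [->|_]; [rewrite !yzD | case: (eqVneq k j) => [->|_];
       [rewrite !yzD | case: (k == y); case: (k == z)]].
  have Mi : M A i = a j.
    rewrite /M AD AE !inE eqxx !orbT big_mkcondr /= big_setU1 ?inE //= big_set1.
    by rewrite eqxx add0r eq_sym ij.
  have Mj : M A j = a i.
    rewrite /M AD AE !inE eqxx !orbT big_mkcondr /= big_setU1 ?inE //= big_set1.
    by rewrite eqxx addr0 ij.
  have -> : \sum_(k in D) M A k * G k = a j * G i + a i * G j.
    rewrite (bigD1 i) //= (bigD1 j) ?jD 1?eq_sym //= Mi Mj big1 ?addr0 // => k.
    move=> /andP[/andP[kD ki] kj]; rewrite /M AE !inE !yzD //.
    by rewrite (negbTE ki) (negbTE kj) mul0r.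
  have Az : A :\ z = y |: [set i; j].
    rewrite AE setUCA setU1K // !inE !negb_or [z == y]eq_sym yz.
    by rewrite ![z == _]eq_sym !yzD.
  have Ay : A :\ y = z |: [set i; j].
    by rewrite AE setU1K // !inE !negb_or yz ![y == _]eq_sym !yzD.
  have coef3 x : x != i -> x != j ->
      (lin a * f)@_(mesym1 (x |: [set i; j])) = a x * f@_(mesym1 [set i; j])
        + a i * f@_(mesym1 [set x; j]) + a j * f@_(mesym1 [set x; i]).
    move=> xi xj; rewrite mcoeff_linM big_setU1 ?in_set2 ?negb_or ?xi //.
    rewrite big_setU1 ?in_set1 // big_set1 /= addrA setU1K ?in_set2 ?negb_or ?xi //.
    rewrite setUCA setU1K ?in_set2 ?negb_or 1?[i == x]eq_sym ?xi //.
    rewrite setUCA [[set i; j]]setUC setUCA setU1K //.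
    by rewrite in_set2 negb_or eq_sym xj eq_sym ij.
  rewrite Az Ay !coef3 ?[_ == i]eq_sym ?[_ == j]eq_sym ?(yzD i iD) ?(yzD j jD) //.
  exact: lin_comb pq0.
have zB : z \in B by have [i [j [_ _ _ ->]]] := std_quarticE BW; rewrite !inE eqxx orbT.
have yB : y \in B by have [i [j [_ _ _ ->]]] := std_quarticE BW; rewrite !inE eqxx.
move=> surj.
(* By surjectivity every cubic monomial is congruent modulo [J] to a multiple of [lin a], and [F]
   vanishes on both. *)
have F0 (A : {set 'I_d}) : #|A| = 3 -> F 'X_[mesym1 A] = 0.
  move=> A3; have [|f _ /FJ] := surj 'X_[mesym1 A].
    by rewrite dhomogX /= mdeg_mesym1 A3.
  by rewrite FD Flin sub0r => /eqP; rewrite oppr_eq0 => /eqP.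
have card3 x : x \in B -> #|B :\ x| = 3.
  by move=> xB; have [] := std_quartic BW; rewrite (cardsD1 x) xB => -[].
have FX (A : {set 'I_d}) : F 'X_[mesym1 A] = \sum_(A' in W)
    theta A' * (p * (A == A' :\ z)%:R + q * (A == A' :\ y)%:R).
  by apply: eq_bigr => A' _; rewrite !mcoeffX !(inj_eq (@inj_mesym1 _)).
have D1_eq x (A : {set 'I_d}) : x \in B -> x \in A -> (B :\ x == A :\ x) = (A == B).
  move=> xB xA; apply/eqP/eqP => [/(congr1 (fun C => x |: C))|->//].
  by rewrite !setD1K.
have Wyz A : A \in W -> (y \in A) && (z \in A).
  by move=> /std_quarticE[i [j [_ _ _ ->]]]; rewrite !inE !eqxx !orbT.
have neq x x' (A : {set 'I_d}) :
    x != x' -> x \in A -> x \in B -> (B :\ x == A :\ x') = false.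
  move=> xx xA xB; apply/eqP => /setP/(_ x); rewrite !inE eqxx xx xA //.
(* The value of [F] is [theta B * p] at [B :\ z] and [theta B * q] at [B :\ y]; one of them is
   nonzero. *)
case/orP: pq => [p0|q0].
  have := F0 _ (card3 z zB); rewrite FX (bigD1 B) //= big1
    => [|A /andP[/[dup] AW /Wyz/andP[yA zA] AB]].
    rewrite eqxx neq // 1?eq_sym // mulr1 mulr0 !addr0 => /eqP.
    by rewrite mulf_eq0 (negbTE thB) (negbTE p0).
  by rewrite D1_eq // (negbTE AB) neq // 1?eq_sym // !mulr0 addr0 mulr0.
have := F0 _ (card3 y yB); rewrite FX (bigD1 B) //= big1
    => [|A /andP[/[dup] AW /Wyz/andP[yA zA] AB]].
  rewrite eqxx neq // mulr1 mulr0 add0r addr0 => /eqP.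
  by rewrite mulf_eq0 (negbTE thB) (negbTE q0).
by rewrite D1_eq // (negbTE AB) neq // !mulr0 addr0 mulr0.
Qed.

End Multiplication.

Lemma not_WLP_initial : ~ WLP J.
Proof.
move=> [f /homog1_lin-> /(_ 2%N)[]]; first exact: not_mul_injective2.
exact: not_mul_surjective2.
Qed.
End NotWLP.

(** * Finite data of the arrangement, checked by computation *)

Fixpoint sublists (T : Type) (s : seq T) : seq (seq T) :=
  if s is x :: s' then sublists s' ++ map (cons x) (sublists s') else [:: [::]].

Lemma mem_sublists (T : eqType) (s u : seq T) : subseq u s -> u \in sublists s.
Proof.
elim: s u => [|x s IHs] [|y u] //=; rewrite mem_cat.
  by move=> _; rewrite IHs ?sub0seq.
case: eqP => [-> /IHs us|_ /IHs ->//].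
by apply/orP; right; apply: map_f.
Qed.

(* The forms [x_1, x_2, x_3, x_1 - x_2, x_1 - x_3, x_2 - x_3, x_4]. *)
Definition form_coefs : seq (seq int) :=
  [:: [:: 1; 0; 0; 0]; [:: 0; 1; 0; 0]; [:: 0; 0; 1; 0]; [:: 1; -1; 0; 0];
      [:: 1; 0; -1; 0]; [:: 0; 1; -1; 0]; [:: 0; 0; 0; 1]].

Definition coef (t j : nat) : int := nth 0 (nth [::] form_coefs t) j.

Definition eval (t : nat) (x : seq int) : int :=
  coef t 0 * nth 0 x 0 + coef t 1 * nth 0 x 1 + coef t 2 * nth 0 x 2
  + coef t 3 * nth 0 x 3.

(** Subsets become increasing lists of indices, so that a claim about all of them turns into a
    closed boolean computation over [sublists]. *)
Definition code (A : {set 'I_7}) : seq nat := [seq val i | i <- enum A].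

Lemma codeE A : code A = [seq k <- iota 0 7 | k \in code A].
Proof.
rewrite /code -val_enum_ord filter_map {1}[enum _]/enum_mem -enumT.
congr map; apply: eq_in_filter => i _ /=; rewrite mem_map ?mem_enum //.
exact: val_inj.
Qed.

Lemma mem_code A (i : 'I_7) : (val i \in code A) = (i \in A).
Proof. by rewrite mem_map ?mem_enum //; apply: val_inj. Qed.

Lemma codeD1 A t : code (A :\ t) = [seq k <- code A | k != val t].
Proof.
rewrite codeE [code A]codeE -filter_predI; apply: eq_in_filter => k.
rewrite mem_iota => k7; have [i ->] : exists i : 'I_7, k = val i by exists (Ordinal k7).
by rewrite /= !mem_code in_setD1.
Qed.

Lemma code_sublists A : code A \in sublists (iota 0 7).
Proof. by apply: mem_sublists; rewrite codeE filter_subseq. Qed.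

Lemma all_iota (P : pred nat) n (i : 'I_n) : all P (iota 0 n) -> P i.
Proof. by move/allP; apply; rewrite mem_iota /=. Qed.

Definition table := seq (seq nat * int).

Fixpoint lookup (s : table) (u : seq nat) : int :=
  if s is (u', c) :: s' then if u == u' then c else lookup s' u else 0.

Definition box : seq (seq int) :=
  let r := [:: 0; 1; -1] : seq int in
  [seq [:: x.1.1; x.1.2; x.2.1; x.2.2]
  | x <- allpairs pair (allpairs pair r r) (allpairs pair r r)].

(* The two hypotheses of [sqf_form_aot], with [x] searched in [{-1, 0, 1}^4]. *)
Definition kills_relations (s : table) : bool :=
  all (fun u =>
    has (fun x => all (fun t => eval t x == lookup s (filter (predC1 t) u)) u) box
    && all (fun t0 => has (fun x => (eval t0 x == lookup s u)
         && all (fun t => (t == t0) || (eval t x == 0)) u) box) u)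
   (sublists (iota 0 7)).

(* The coordinates of the degree 4 part of the AOT algebra in the basis of the
   monomials listed in [nbc_bases]. *)
Definition top_tables : seq table :=
  [:: [:: ([:: 0; 1; 2; 6]%N, 1); ([:: 0; 1; 4; 6]%N, -1); ([:: 0; 1; 5; 6]%N, -1);
          ([:: 0; 2; 3; 6]%N, -1); ([:: 0; 3; 4; 6]%N, 1); ([:: 0; 3; 5; 6]%N, 1)];
      [:: ([:: 0; 1; 2; 6]%N, -1); ([:: 0; 1; 4; 6]%N, 1); ([:: 0; 2; 3; 6]%N, 1);
          ([:: 0; 2; 5; 6]%N, -1); ([:: 0; 3; 4; 6]%N, -1); ([:: 0; 4; 5; 6]%N, 1)];
      [:: ([:: 0; 1; 2; 6]%N, -1); ([:: 0; 1; 4; 6]%N, 1); ([:: 0; 1; 5; 6]%N, 1);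
          ([:: 1; 2; 3; 6]%N, -1); ([:: 1; 3; 4; 6]%N, 1); ([:: 1; 3; 5; 6]%N, 1)];
      [:: ([:: 0; 1; 4; 6]%N, -1); ([:: 1; 2; 4; 6]%N, -1); ([:: 1; 3; 4; 6]%N, -1);
          ([:: 1; 4; 5; 6]%N, 1)];
      [:: ([:: 0; 2; 3; 6]%N, 1); ([:: 1; 2; 3; 6]%N, 1); ([:: 2; 3; 4; 6]%N, 1);
          ([:: 2; 3; 5; 6]%N, 1)];
      [:: ([:: 0; 1; 2; 6]%N, 1); ([:: 0; 2; 3; 6]%N, -1); ([:: 0; 2; 5; 6]%N, 1);
          ([:: 1; 2; 4; 6]%N, 1); ([:: 2; 3; 4; 6]%N, -1); ([:: 2; 4; 5; 6]%N, 1)]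
  ].

(** The no-broken-circuit bases when larger indices come first: 6, 5, one of 3 and 4, and one of 0,
    1 and 2. *)
Definition nbc_bases : seq (seq nat) :=
  [:: [:: 0; 3; 5; 6]; [:: 0; 4; 5; 6]; [:: 1; 3; 5; 6]; [:: 1; 4; 5; 6];
      [:: 2; 3; 5; 6]; [:: 2; 4; 5; 6]]%N.

Lemma top_tables_kill : all kills_relations top_tables.
Proof. by lazy. Qed.

Lemma top_tables_bases i k : (i < 6)%N -> (k < 6)%N ->
  lookup (nth [::] top_tables i) (nth [::] nbc_bases k) = (i == k)%:R.
Proof. by move: i k; do 6?case=> //; do 6?case. Qed.

(** Independent flats of the matroid: the listed forms are independent and no other form lies in
    their span. A relation having all but one of its forms in such a set is therefore impossible,
    and the monomial of the set never occurs in the ideal. *)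
Definition flats : seq (seq nat) :=
  [:: [:: 6]; [:: 0; 5]; [:: 0; 6]; [:: 1; 6]; [:: 2; 6]; [:: 3; 6]; [:: 4; 6];
      [:: 5; 6]]%N.

Lemma flats_kill : all (fun u => kills_relations [:: (u, 1)]) flats.
Proof. by lazy. Qed.

Definition oset (u : seq nat) : {set 'I_7} := [set i | val i \in u].

Lemma code_oset u : code (oset u) = [seq k <- iota 0 7 | k \in u].
Proof.
rewrite codeE; apply: eq_in_filter => k; rewrite mem_iota => k7.
have [i ->] : exists i : 'I_7, k = val i by exists (Ordinal k7).
by rewrite mem_code inE.
Qed.

Lemma code_inj : injective code.
Proof. by move=> A B AB; apply/setP => i; rewrite -!mem_code AB. Qed.

(** * The seven forms over [K] and the functionals given by the tables *)

Section Braid.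
Variable K : fieldType.
Hypothesis charK0 : [pchar K] =i pred0.

Definition coordinate n (j : 'I_n) (x : 'rV[K]_n) : K^o := x 0 j.

Lemma coordinate_linear n (j : 'I_n) : linear (coordinate j).
Proof. by move=> c u v; rewrite /coordinate !mxE. Qed.

HB.instance Definition _ n (j : 'I_n) := GRing.isLinear.Build K 'rV[K]_n K^o *:%R
  (coordinate j) (coordinate_linear j).

Definition braid_form (t : 'I_7) : 'Hom('rV[K]_4, K^o) :=
  \sum_(j < 4) (coef t j)%:~R *: linfun (coordinate j).

Lemma formE t x : braid_form t x = \sum_(j < 4) (coef t j)%:~R * x 0 j.
Proof. by rewrite sum_lfunE; apply: eq_bigr => j _; rewrite scale_lfunE lfunE. Qed.

Lemma form_eval t x : braid_form t (\row_j (nth 0 x j)%:~R) = (eval t x)%:~R.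
Proof.
rewrite formE !big_ord_recl big_ord0 addr0 !mxE /eval !addrA.
by rewrite !rmorphD /= !intrM.
Qed.

Lemma form_comb3 (i j k : 'I_7) (a b c : int) :
    all (fun s => a * coef i s + b * coef j s + c * coef k s == 0) (iota 0 4) ->
  a%:~R *: braid_form i + b%:~R *: braid_form j + c%:~R *: braid_form k = 0.
Proof.
move=> /allP abc0; rewrite !scaler_sumr -!big_split big1 //= => s _.
rewrite !scalerA -!scalerDl -!intrM -!intrD (eqP (abc0 s _)) ?scale0r //.
by rewrite mem_iota /=.
Qed.

Lemma intr_neq0 (c : int) : c != 0 -> c%:~R != 0 :> K.
Proof.
have natr_neq0 n : n.+1%:R != 0 :> K by rewrite (pcharf0P K).1.
by case: c => [[|n]|n] // _; rewrite ?NegzE ?mulrNz ?oppr_eq0 natr_neq0.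
Qed.

(** Any two forms have a nonzero integer 2 x 2 minor, found by computation, which stays nonzero in
    characteristic 0; a zero form would be proportional to every other one. *)
Lemma form_arrangement : is_arrangement braid_form.
Proof.
have minor (i j : 'I_7) : i != j -> exists p q : 'I_4,
    coef i p * coef j q - coef i q * coef j p != 0.
  move=> ij; pose minors (i j : nat) := [seq (x.1 < 4)%N && (x.2 < 4)%N
    && (coef i x.1 * coef j x.2 - coef i x.2 * coef j x.1 != 0)
    | x <- allpairs pair (iota 0 4) (iota 0 4)].
  have minorsP : all (fun i => all (fun j => (i == j) || has id (minors i j))
    (iota 0 7)) (iota 0 7) by lazy.
  have := all_iota j (all_iota i minorsP); rewrite val_eqE (negbTE ij).
  rewrite has_map => /hasP[[p q] _ /andP[/andP[/= p4 q4] pq]].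
  by exists (Ordinal p4), (Ordinal q4).
have form_delta i (p : 'I_4) : braid_form i (delta_mx 0 p) = (coef i p)%:~R.
  rewrite formE (bigD1 p) //= mxE !eqxx mulr1 big1 ?addr0 // => q qp.
  by rewrite mxE (negbTE qp) andbF mulr0.
have indep i j : i != j -> ~ exists a : K, braid_form i = a *: braid_form j.
  move=> /minor[p [q pq]] [a ija]; have /eqP := intr_neq0 pq; apply.
  rewrite rmorphB /= !intrM -!form_delta ija !scale_lfunE /=.
  by rewrite -!/(_ * _) mulrAC subrr.
split=> // i; have [j ij] : exists j : 'I_7, i != j.
  by exists (if i == ord0 then ord_max else ord0); case: (eqVneq i ord0) => [->|].
apply/eqP => i0; apply: (indep _ _ ij); exists 0.
by rewrite i0 scale0r.
Qed.

Local Notation I := (aot_ideal braid_form).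

Definition phi (s : table) (A : {set 'I_7}) : K := (lookup s (code A))%:~R.

Lemma phi_aot s f : kills_relations s -> I f -> sqf_form (phi s) f = 0.
Proof.
move=> /allP skill; apply: sqf_form_aot => [U|U t0 t0U].
  have /andP[/hasP[x _ /allP xP] _] := skill _ (code_sublists U).
  exists (\row_j (nth 0 x j)%:~R) => t tU; rewrite form_eval /phi codeD1.
  by rewrite (eqP (xP t _)) ?mem_code.
have /andP[_ /allP/(_ t0)] := skill _ (code_sublists U).
rewrite mem_code => /(_ t0U)/hasP[x _ /andP[/eqP xt0 /allP x0]].
exists (\row_j (nth 0 x j)%:~R); split=> [|t tU tt0]; rewrite form_eval ?xt0 //.
by have := x0 t; rewrite mem_code tU val_eqE (negbTE tt0) => /(_ isT)/eqP->.
Qed.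

(** Taking this coefficient is the functional of the one-entry table [[:: (u, 1)]]. *)
Lemma mcoeff_flat u f : u \in flats -> I f -> f@_(mesym1 (oset u)) = 0.
Proof.
move=> uF If; rewrite -(phi_aot (allP flats_kill _ uF) If).
rewrite /sqf_form (bigD1 (oset u)) //= big1 => [|A Au].
  rewrite addr0 /phi code_oset.
  suff -> : [seq k <- iota 0 7 | k \in u] = u by rewrite /= eqxx mulr1.
  by apply/eqP; move: u uF; apply/allP; lazy.
rewrite /phi /=; case: eqP => [E|_]; last by rewrite mulr0.
case/eqP: Au; apply: code_inj; rewrite E code_oset.
by apply/esym/eqP; move: {E} u uF; apply/allP; lazy.
Qed.

End Braid.

(** * The Weak Lefschetz Property of the AOT algebra *)

Section BraidIdeal.
Variable K : fieldType.
Hypothesis charK0 : [pchar K] =i pred0.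
Local Notation I := (aot_ideal (@braid_form K)).
Local Notation y n := ('X_(inord n) : {mpoly K[7]}).

Let natr_neq0 n : n.+1%:R != 0 :> K.
Proof. by rewrite (pcharf0P K).1. Qed.

Lemma square_aot i : I ('X_i * 'X_i).
Proof. by apply: ideal_gen_mem; right; exists i; rewrite expr2. Qed.

Lemma triangle_aot (i j k : 'I_7) (a b c : int) :
    i != j -> i != k -> j != k -> a != 0 ->
    all (fun s => a * coef i s + b * coef j s + c * coef k s == 0) (iota 0 4) ->
  I (a%:~R *: ('X_j * 'X_k) + b%:~R *: ('X_i * 'X_k) + c%:~R *: ('X_i * 'X_j)).
Proof.
move=> ij ik jk a0 /(form_comb3 K) rel0.
pose w t : K := if t == i then a%:~R else if t == j then b%:~R else c%:~R.
have iL : i \notin [set j; k] by rewrite in_set2 negb_or ij.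
have jL : j \notin [set k] by rewrite in_set1.
have [wi wj wk] : [/\ w i = a%:~R, w j = b%:~R & w k = c%:~R].
  by rewrite /w !eqxx ![_ == i]eq_sym (negbTE ij) (negbTE ik) eq_sym (negbTE jk).
have rel : nontrivial_relation (@braid_form K) (i |: [set j; k]) w.
  split; first by exists i; rewrite ?setU11 // wi intr_neq0.
  by rewrite big_setU1 //= big_setU1 //= big_set1 wi wj wk addrA.
apply: ideal_gen_mem; left; exists (i |: [set j; k]), w; split=> //.
  exact: codim_inter_lt_card rel.
rewrite /relation_poly big_setU1 //= big_setU1 //= big_set1 wi wj wk addrA.
rewrite setU1K //; congr (_ *: _ + _ *: _ + _ *: _).
- by rewrite big_setU1 //= big_set1.
- rewrite setUCA setU1K ?in_set2 ?negb_or 1?[j == i]eq_sym ?ij //.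
  by rewrite big_setU1 ?in_set1 //= big_set1.
rewrite [[set j; k]]setUC setUCA setU1K ?in_set2 ?negb_or 1?[k == i]eq_sym ?ik 1?eq_sym //.
by rewrite big_setU1 ?in_set1 //= big_set1.
Qed.

Let inord_neq a b : (a < 7)%N -> (b < 7)%N -> a != b -> inord a != inord b :> 'I_7.
Proof. by move=> a7 b7; rewrite -val_eqE /= !inordK. Qed.

(** This and the next three are the relations of the three-element circuits of A_3, the triangles of
    the complete graph on four vertices. *)
Let t013 : I (y 1 * y 3 - y 0 * y 3 - y 0 * y 1).
Proof.
have := @triangle_aot (inord 0) (inord 1) (inord 3) 1 (-1) (-1).
rewrite !mulrN1z !scaleN1r scale1r; apply; rewrite ?inord_neq //.
by rewrite !inordK //; lazy.
Qed.

Let t024 : I (y 2 * y 4 - y 0 * y 4 - y 0 * y 2).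
Proof.
have := @triangle_aot (inord 0) (inord 2) (inord 4) 1 (-1) (-1).
rewrite !mulrN1z !scaleN1r scale1r; apply; rewrite ?inord_neq //.
by rewrite !inordK //; lazy.
Qed.

Let t125 : I (y 2 * y 5 - y 1 * y 5 - y 1 * y 2).
Proof.
have := @triangle_aot (inord 1) (inord 2) (inord 5) 1 (-1) (-1).
rewrite !mulrN1z !scaleN1r scale1r; apply; rewrite ?inord_neq //.
by rewrite !inordK //; lazy.
Qed.

Let t345 : I (y 4 * y 5 - y 3 * y 5 + y 3 * y 4).
Proof.
have := @triangle_aot (inord 3) (inord 4) (inord 5) 1 (-1) 1.
rewrite !mulrN1z !scaleN1r !scale1r; apply; rewrite ?inord_neq //.
by rewrite !inordK //; lazy.
Qed.

Definition lf (c0 c1 c2 c3 c4 c5 : int) : {mpoly K[7]} :=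
  y 0 *~ c0 + y 1 *~ c1 + y 2 *~ c2 + y 3 *~ c3 + y 4 *~ c4 + y 5 *~ c5.

Lemma homog_lf c0 c1 c2 c3 c4 c5 : lf c0 c1 c2 c3 c4 c5 \is 1.-homog.
Proof.
have homog_y n c : y n *~ c \is 1.-homog by rewrite rpredMz // dhomogX /= mdeg1.
by rewrite /lf !rpredD.
Qed.

Local Notation m := (lf (-1) 1 1 1 1 1).

Definition spanned (g : {mpoly K[7]}) : Prop :=
  exists2 f, f \is 1.-homog & I (g - m ^+ 2 * f).

Lemma spanned_aot g : I g -> spanned g.
Proof. by exists 0; rewrite ?dhomog0 // mulr0 subr0. Qed.

Lemma spannedB f g : spanned f -> spanned g -> spanned (f - g).
Proof.
move=> [f1 hf If] [g1 hg Ig]; exists (f1 - g1); first exact: rpredB.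
have -> : f - g - m ^+ 2 * (f1 - g1) = f - m ^+ 2 * f1 - (g - m ^+ 2 * g1) by ring.
exact: ideal_genD If (ideal_genN Ig).
Qed.

(* The instances below come from inverting the 6 x 6 matrix of [m^2 : B_1 -> B_3];
   12 is the common denominator of the inverse. *)
Lemma spanned_cert g (f q0 q1 q2 q3 s0 s1 s2 s3 s4 s5 : {mpoly K[7]}) :
    f \is 1.-homog ->
    12 * g = m ^+ 2 * f
      + q0 * (y 1 * y 3 - y 0 * y 3 - y 0 * y 1)
      + q1 * (y 2 * y 4 - y 0 * y 4 - y 0 * y 2)
      + q2 * (y 2 * y 5 - y 1 * y 5 - y 1 * y 2)
      + q3 * (y 4 * y 5 - y 3 * y 5 + y 3 * y 4)
      + s0 * (y 0 * y 0) + s1 * (y 1 * y 1) + s2 * (y 2 * y 2)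
      + s3 * (y 3 * y 3) + s4 * (y 4 * y 4) + s5 * (y 5 * y 5) ->
  spanned g.
Proof.
move=> f1 gE; exists (12^-1 *: f); first exact: rpredZ.
have -> : g - m ^+ 2 * (12^-1 *: f) = 12^-1 *: (12 * g - m ^+ 2 * f).
  by rewrite scalerBr -scalerAr mulr_natl -(scaler_nat 12 g) scalerA mulVf ?scale1r.
apply: ideal_genZ; rewrite gE -!addrA addrC !addrA addrNK.
by do ![apply: ideal_genD]; apply: ideal_genM => //; apply: square_aot.
Qed.

Lemma spanned_035 : spanned (y 0 * y 3 * y 5).
Proof.
apply: (@spanned_cert _ (lf 1 5 (-1) (-1) (-1) (-1))
  (lf 6 0 0 0 (-6) 0) (lf (-6) 0 0 6 0 0)
  (lf (-6) (-6) 0 6 6 0) (lf (-6) 0 0 6 0 0)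
  (lf (-1) 3 (-3) 9 (-3) 3) (lf 9 (-5) (-15) (-9) (-9) (-15))
  (lf (-3) (-3) 1 3 3 3) (lf (-3) (-3) 3 1 (-3) 9)
  (lf (-3) (-3) 3 3 1 3) (lf (-3) (-3) 3 3 3 1)
  (homog_lf _ _ _ _ _ _)).
rewrite /lf; ring.
Qed.

Lemma spanned_045 : spanned (y 0 * y 4 * y 5).
Proof.
apply: (@spanned_cert _ (lf 3 (-3) 3 (-3) (-3) 3)
  (lf (-18) 0 0 0 18 0) (lf (-6) 0 0 6 0 0)
  (lf 6 (-6) 0 (-6) (-6) 0) (lf 6 0 0 6 0 0)
  (lf (-3) (-9) (-3) (-9) 3 3) (lf (-9) 3 (-3) 9 9 (-3))
  (lf 3 (-3) (-3) (-3) (-3) (-9)) (lf (-9) 9 3 3 3 9)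
  (lf (-9) 9 3 9 3 3) (lf 3 (-3) (-9) (-3) (-3) (-3))
  (homog_lf _ _ _ _ _ _)).
rewrite /lf; ring.
Qed.

Lemma spanned_135 : spanned (y 1 * y 3 * y 5).
Proof.
apply: (@spanned_cert _ (lf 4 2 (-4) 2 (-4) 2)
  (lf 0 0 0 0 0 0) (lf (-24) 12 0 12 0 12)
  (lf 0 0 0 0 0 0) (lf 0 0 0 0 0 0)
  (lf (-4) 6 (-12) 6 (-12) 6) (lf 0 (-2) 0 (-6) 0 (-6))
  (lf (-12) 6 4 6 12 6) (lf 0 (-6) 0 (-2) 0 (-6))
  (lf (-12) 6 12 6 4 6) (lf 0 (-6) 0 (-6) 0 (-2))
  (homog_lf _ _ _ _ _ _)).
rewrite /lf; ring.
Qed.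

Lemma spanned_145 : spanned (y 1 * y 4 * y 5).
Proof.
apply: (@spanned_cert _ (lf 1 (-1) (-1) (-1) (-1) 5)
  (lf (-6) 0 0 0 6 (-12)) (lf (-6) 0 0 6 0 0)
  (lf 6 (-6) 0 (-6) (-6) 0) (lf 6 0 0 (-6) 0 0)
  (lf (-1) (-3) (-3) (-3) (-3) (-3)) (lf (-3) 1 (-3) 3 3 (-9))
  (lf (-3) 3 1 3 3 (-3)) (lf (-3) 3 3 1 9 (-9))
  (lf (-3) 3 3 3 1 (-3)) (lf 9 (-9) (-9) (-9) (-9) (-5))
  (homog_lf _ _ _ _ _ _)).
rewrite /lf; ring.
Qed.

Lemma spanned_235 : spanned (y 2 * y 3 * y 5).
Proof.
apply: (@spanned_cert _ (lf (-1) 1 1 1 1 1)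
  (lf 6 0 0 0 (-6) 0) (lf 6 0 0 (-6) 0 (-12))
  (lf (-6) (-6) 0 6 6 0) (lf (-6) 0 0 (-6) 0 0)
  (lf 1 3 3 3 3 (-3)) (lf 3 (-1) (-9) (-3) (-3) (-9))
  (lf 3 (-3) (-1) (-3) (-3) (-3)) (lf 3 (-3) (-3) (-1) 3 (-9))
  (lf 3 (-3) (-3) (-3) (-1) (-3)) (lf 3 (-3) (-3) (-3) (-3) (-1))
  (homog_lf _ _ _ _ _ _)).
rewrite /lf; ring.
Qed.

Lemma spanned_245 : spanned (y 2 * y 4 * y 5).
Proof.
apply: (@spanned_cert _ (lf 4 (-4) 2 (-4) 2 2)
  (lf (-24) 0 12 0 12 12) (lf 0 0 0 0 0 0)
  (lf 0 0 0 0 0 0) (lf 0 0 0 0 0 0)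
  (lf (-4) (-12) 6 (-12) 6 6) (lf (-12) 4 6 12 6 6)
  (lf 0 0 (-2) 0 (-6) (-6)) (lf (-12) 12 6 4 6 6)
  (lf 0 0 (-6) 0 (-2) (-6)) (lf 0 0 (-6) 0 (-6) (-2))
  (homog_lf _ _ _ _ _ _)).
rewrite /lf; ring.
Qed.

Lemma spanned_mod p q f g : I q -> spanned f -> f - g = p * q -> spanned g.
Proof.
move=> Iq [f1 hf If] fg; exists f1 => //.
have -> : g - m ^+ 2 * f1 = (f - m ^+ 2 * f1) - p * q by rewrite -fg; ring.
exact: ideal_genD If (ideal_genN (ideal_genM _ Iq)).
Qed.

(** From here to [spanned_012], a multiple of a triangle relation writes the monomial as a
    difference of two monomials already treated. *)
Lemma spanned_034 : spanned (y 0 * y 3 * y 4).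
Proof.
by apply: (spanned_mod (p := - y 0) t345 (spannedB spanned_035 spanned_045)); ring.
Qed.

Lemma spanned_134 : spanned (y 1 * y 3 * y 4).
Proof.
by apply: (spanned_mod (p := - y 1) t345 (spannedB spanned_135 spanned_145)); ring.
Qed.

Lemma spanned_234 : spanned (y 2 * y 3 * y 4).
Proof.
by apply: (spanned_mod (p := - y 2) t345 (spannedB spanned_235 spanned_245)); ring.
Qed.

Lemma spanned_015 : spanned (y 0 * y 1 * y 5).
Proof.
by apply: (spanned_mod (p := y 5) t013 (spannedB spanned_135 spanned_035)); ring.
Qed.

Lemma spanned_025 : spanned (y 0 * y 2 * y 5).
Proof.
by apply: (spanned_mod (p := y 5) t024 (spannedB spanned_245 spanned_045)); ring.
Qed.

Lemma spanned_123 : spanned (y 1 * y 2 * y 3).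
Proof.
by apply: (spanned_mod (p := y 3) t125 (spannedB spanned_235 spanned_135)); ring.
Qed.

Lemma spanned_124 : spanned (y 1 * y 2 * y 4).
Proof.
by apply: (spanned_mod (p := y 4) t125 (spannedB spanned_245 spanned_145)); ring.
Qed.

Lemma spanned_014 : spanned (y 0 * y 1 * y 4).
Proof.
by apply: (spanned_mod (p := y 4) t013 (spannedB spanned_134 spanned_034)); ring.
Qed.

Lemma spanned_023 : spanned (y 0 * y 2 * y 3).
Proof.
by apply: (spanned_mod (p := y 3) t024 (spannedB spanned_234 spanned_034)); ring.
Qed.

Lemma spanned_012 : spanned (y 0 * y 1 * y 2).
Proof.
by apply: (spanned_mod (p := y 0) t125 (spannedB spanned_025 spanned_015)); ring.
Qed.

(** For the three variables of a triangle, multiplying its relation by one of them leaves only their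
    product and multiples of a square, so the product lies in the ideal. *)
Lemma spanned_013 : spanned (y 0 * y 1 * y 3).
Proof.
apply: spanned_aot.
have -> : y 0 * y 1 * y 3 = y 0 * (y 1 * y 3 - y 0 * y 3 - y 0 * y 1) + (y 1 + y 3) * (y 0 * y 0) by ring.
exact: ideal_genD (ideal_genM _ t013) (ideal_genM _ (square_aot _)).
Qed.

Lemma spanned_024 : spanned (y 0 * y 2 * y 4).
Proof.
apply: spanned_aot.
have -> : y 0 * y 2 * y 4 = y 0 * (y 2 * y 4 - y 0 * y 4 - y 0 * y 2) + (y 2 + y 4) * (y 0 * y 0) by ring.
exact: ideal_genD (ideal_genM _ t024) (ideal_genM _ (square_aot _)).
Qed.

Lemma spanned_125 : spanned (y 1 * y 2 * y 5).
Proof.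
apply: spanned_aot.
have -> : y 1 * y 2 * y 5 = y 1 * (y 2 * y 5 - y 1 * y 5 - y 1 * y 2) + (y 2 + y 5) * (y 1 * y 1) by ring.
exact: ideal_genD (ideal_genM _ t125) (ideal_genM _ (square_aot _)).
Qed.

Lemma spanned_345 : spanned (y 3 * y 4 * y 5).
Proof.
apply: spanned_aot.
have -> : y 3 * y 4 * y 5 = y 3 * (y 4 * y 5 - y 3 * y 5 + y 3 * y 4) + (y 5 - y 4) * (y 3 * y 3) by ring.
exact: ideal_genD (ideal_genM _ t345) (ideal_genM _ (square_aot _)).
Qed.

(** A repeated index gives a multiple of a square; otherwise transpositions sort the indices, and
    the twenty increasing triples are the cases above. *)
Lemma spanned_cubic i j k : (i < 6)%N -> (j < 6)%N -> (k < 6)%N ->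
  spanned (y i * y j * y k).
Proof.
pose P i j k := spanned (y i * y j * y k).
have sorted i' j' k' : (i' < j')%N -> (j' < k')%N -> (k' < 6)%N -> P i' j' k'.
  move: i' j' k' => [|[|[|[|[|[|?]]]]]] [|[|[|[|[|[|?]]]]]] [|[|[|[|[|[|?]]]]]] // _ _ _;
    [ exact: spanned_012 | exact: spanned_013 | exact: spanned_014
    | exact: spanned_015 | exact: spanned_023 | exact: spanned_024
    | exact: spanned_025 | exact: spanned_034 | exact: spanned_035
    | exact: spanned_045 | exact: spanned_123 | exact: spanned_124
    | exact: spanned_125 | exact: spanned_134 | exact: spanned_135
    | exact: spanned_145 | exact: spanned_234 | exact: spanned_235
    | exact: spanned_245 | exact: spanned_345].
have P12 i' j' k' : P i' j' k' -> P j' i' k' by rewrite /P (mulrC (y i')).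
have P23 i' j' k' : P i' j' k' -> P i' k' j' by rewrite /P mulrAC.
have Psq i' j' : P i' i' j' by apply/spanned_aot/ideal_genMr/square_aot.
move=> i6 j6 k6; rewrite -/(P i j k).
have [ij|ij|<-] := ltngtP i j; last exact: Psq.
  have [jk|jk|<-] := ltngtP j k; [exact: sorted | | exact/P12/P23/Psq].
  by have [ik|ik|<-] := ltngtP i k;
    [exact/P23/sorted | exact/P23/P12/sorted | exact/P23/Psq].
have [jk|jk|<-] := ltngtP j k; [|exact/P12/P23/P12/sorted|exact/P12/P23/Psq].
by have [ik|ik|<-] := ltngtP i k;
  [exact/P12/sorted | exact/P12/P23/sorted | exact/P23/Psq].
Qed.

Local Notation z := (ord_max : 'I_7).

(** The coefficients of the Lefschetz element z + m. *)
Definition weight (i : 'I_7) : K := if i == ord0 then -1 else 1.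

Local Notation Lf := (lin weight).

Let rest : {mpoly K[7]} := \sum_(i | i != z) weight i *: 'X_i.

Let lin_weight : Lf = 'X_z + rest.
Proof. by rewrite /lin (bigD1 z) //= /weight scale1r. Qed.

Let rest_lf : rest = m.
Proof.
rewrite /rest /lf !mulrN1z big_mkcond !big_ord_recl big_ord0 /= addr0 /weight /=.
rewrite !scale1r scaleN1r !addrA addr0.
by do ![congr (_ + _)]; try congr (- _); congr 'X_ _; apply: val_inj; rewrite /= inordK.
Qed.

Definition attained e (g : {mpoly K[7]}) : Prop :=
  exists2 f, f \is e.-homog & I (Lf * f - g).

Lemma attained_aot e g : I g -> attained e g.
Proof. by exists 0; rewrite ?dhomog0 // mulr0 sub0r; apply: ideal_genN. Qed.

Lemma attainedD e f g : attained e f -> attained e g -> attained e (f + g).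
Proof.
move=> [f1 hf If] [g1 hg Ig]; exists (f1 + g1); first exact: rpredD.
by rewrite mulrDr opprD addrACA; apply: ideal_genD.
Qed.

Lemma attainedZ e c g : attained e g -> attained e (c *: g).
Proof.
move=> [f hf If]; exists (c *: f); first exact: rpredZ.
by rewrite -scalerAr -scalerBr; apply: ideal_genZ.
Qed.

Lemma attained_sum e (T : Type) (r : seq T) (P : pred T) (F : T -> {mpoly K[7]}) :
  (forall i, P i -> attained e (F i)) -> attained e (\sum_(i <- r | P i) F i).
Proof.
apply: big_ind => [|f g]; last exact: attainedD.
exact/attained_aot/ideal_gen0.
Qed.

(* [(z + m) (m - z) = m^2 - z^2] and [z^2] is in the ideal. *)
Lemma attained_spanned g : spanned g -> attained 2 g.
Proof.
move=> [f f1 If]; exists ((m - 'X_z) * f).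
  by rewrite -[2%N]/(1 + 1)%N dhomogM // rpredB ?homog_lf // dhomogX /= mdeg1.
have -> : Lf * ((m - 'X_z) * f) - g = - (g - m ^+ 2 * f) - f * ('X_z * 'X_z).
  by rewrite lin_weight rest_lf; ring.
apply: ideal_genD (ideal_genN If) _.
exact: ideal_genN (ideal_genM _ (square_aot _)).
Qed.

(** Without the factor z, this is the surjectivity of m^2. With one such factor, z w = (z + m) w - m
    w, and m w is a combination of cubic monomials without z. With two, the monomial is in the
    ideal. *)
Lemma attained_cubic i j k : attained 2 ('X_i * 'X_j * 'X_k).
Proof.
have lt6 (t : 'I_7) : t != z -> (t < 6)%N.
  by move=> tz; have := ltn_ord t; rewrite ltnS leq_eqVlt => /orP[tE|//]; case/negP: tz.
have nz i' j' k' : i' != z -> j' != z -> k' != z -> attained 2 ('X_i' * 'X_j' * 'X_k').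
  move=> /lt6 i6 /lt6 j6 /lt6 k6; rewrite -[i']inord_val -[j']inord_val -[k']inord_val.
  exact/attained_spanned/spanned_cubic.
have z3 i' j' : i' != z -> j' != z -> attained 2 ('X_z * 'X_i' * 'X_j').
  move=> iz jz; have [f hf If] : attained 2 (rest * ('X_i' * 'X_j')).
    rewrite mulr_suml; apply: attained_sum => t tz.
    by rewrite -scalerAl mulrA; apply: attainedZ; apply: nz.
  exists ('X_i' * 'X_j' - f).
    by rewrite rpredB // -mpolyXD dhomogX /= mdegD !mdeg1.
  have -> : Lf * ('X_i' * 'X_j' - f) - 'X_z * 'X_i' * 'X_j'
    = - (Lf * f - rest * ('X_i' * 'X_j')) by rewrite lin_weight; ring.
  exact: ideal_genN.
have zz t : attained 2 ('X_z * 'X_z * 'X_t).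
  exact/attained_aot/ideal_genMr/square_aot.
have [->|iz] := eqVneq i z.
  have [->|jz] := eqVneq j z; first exact: zz.
  have [->|kz] := eqVneq k z; first by rewrite mulrAC; apply: zz.
  exact: z3.
have [->|jz] := eqVneq j z.
  rewrite ['X_i * _]mulrC; have [->|kz] := eqVneq k z; last exact: z3.
  by rewrite mulrAC; apply: zz.
have [->|kz] := eqVneq k z; last exact: nz.
by rewrite mulrC mulrA; apply: z3.
Qed.

Lemma mdeg_split d (u : 'X_{1..d}) : (0 < mdeg u)%N -> exists i u', u = (U_(i) + u')%MM.
Proof.
rewrite lt0n mdeg_eq0 => u0.
have [i ui] : exists i, u i != 0%N.
  apply/existsP; apply: contraNT u0; rewrite negb_exists => /forallP u0.
  by apply/eqP/mnmP => i; rewrite mnm0E; apply/eqP; rewrite -[_ == _]negbK.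
by exists i, (u - U_(i))%MM; rewrite addmC submK // lep1mP.
Qed.

(** A monomial of degree at least 3 is a multiple of a cubic one, and a preimage of the cubic factor
    may be multiplied by the cofactor. *)
Lemma attained_homog e g : (2 <= e)%N -> g \is e.+1.-homog -> attained e g.
Proof.
case: e => [|[|e]] // _ /dhomogP g_homog.
rewrite [g]mpolyE big_seq; apply: attained_sum => u /g_homog /= mu.
apply: attainedZ; move: mu.
have [->|] := posnP (mdeg u) => // /mdeg_split[i [u1 ->]].
rewrite mdegD mdeg1 add1n => -[mu1].
have /mdeg_split[j [u2 u1E]] : (0 < mdeg u1)%N by rewrite mu1.
move: mu1; rewrite u1E mdegD mdeg1 add1n => -[mu2].
have /mdeg_split[k [u3 u2E]] : (0 < mdeg u2)%N by rewrite mu2.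
move: mu2; rewrite u2E mdegD mdeg1 add1n => -[mu3].
have [f f2 If] := attained_cubic i j k; exists (f * 'X_[u3]).
  by rewrite -[e.+2]/(2 + e)%N dhomogM // dhomogX /= mu3.
rewrite !mpolyXD !mulrA -mulrBl; exact: ideal_genMr.
Qed.

Lemma weight_neq0 i : weight i != 0.
Proof. by rewrite /weight; case: ifP; rewrite ?oppr_eq0 oner_neq0. Qed.

Lemma braid_WLP : WLP I.
Proof.
exists Lf; first exact: homog_lin.
have oset1 : oset [:: 6%N] = [set z].
  by apply/setP => i; rewrite !inE -val_eqE.
(* Injectivity in degrees 0 and 1, surjectivity from degree 2 on; the cases follow in decreasing
   degree. *)
move=> [|[|e]]; [left|left|right]; last first.
- by move=> g /attained_homog[] // f f_homog If; exists f.
- move=> f g f1 g1; rewrite /eq_mod -mulrBr => If.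
  have {f1 g1} : f - g \is 1.-homog by rewrite rpredB.
  move: (f - g) If => {f g} f If /homog1_lin fE; move: If; rewrite fE.
  move: (fun i => f@_(U_(i))) => b {f fE} If.
  (* The pair of [i] and [z] is a flat, so the coefficient [b i + weight i * b z] of the product
     vanishes. *)
  have bz i : i != z -> b i = - weight i * b z.
    move=> iz; have iF : [:: val i; 6%N] \in flats.
      by case: i iz => [[|[|[|[|[|[|[]]]]]]]].
    have iE : oset [:: val i; 6%N] = [set i; z].
      by apply/setP => j; rewrite !inE -!val_eqE.
    have := mcoeff_flat iF If; rewrite iE mcoeff_linM2 // {2}/weight /= mul1r addrC.
    by move/eqP; rewrite addr_eq0 mulNr => /eqP.
  (* At the flat {0, 5} the opposite weights make both contributions equal to [b z], so the
     vanishing coefficient is [2 * b z]. *)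
  have b0 : b z = 0.
    have := mcoeff_flat (isT : [:: 0; 5]%N \in flats) If.
    have -> : oset [:: 0; 5]%N = [set inord 0; inord 5].
      by apply/setP => j; rewrite !inE -!val_eqE /= !inordK.
    have nz n : (n < 6)%N -> inord n != z by move=> n6; rewrite -val_eqE /= inordK; lia.
    have w0 : weight (inord 0) = -1 by rewrite /weight -val_eqE /= inordK.
    have w5 : weight (inord 5) = 1 by rewrite /weight -val_eqE /= inordK.
    rewrite mcoeff_linM2 ?inord_neq // (bz (inord 0)) ?nz // (bz (inord 5)) ?nz //.
    rewrite w0 w5 => /eqP.
    have -> : -1 * (- 1 * b z) + 1 * (- -1 * b z) = 2 * b z by ring.
    by rewrite mulf_eq0 (negbTE (natr_neq0 1)) => /eqP.
  rewrite /lin big1 => [|i _]; first exact: ideal_gen0.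
  by have [->|/bz ->] := eqVneq i z; rewrite b0 ?mulr0 scale0r.
move=> f g f0 g0; rewrite /eq_mod -mulrBr => If.
have {f0 g0} /dhomogP f0 : f - g \is 0.-homog by rewrite rpredB.
suff -> : f - g = 0 by apply: ideal_gen0.
apply/mpolyP => u; rewrite mcoeff0;
have [/f0 /= /eqP|] := boolP (u \in msupp (f - g)); last first.
  exact: memN_msupp_eq0.
rewrite mdeg_eq0 => /eqP->; have := mcoeff_flat (isT : [:: 6]%N \in flats) If.
rewrite oset1 mcoeff_linM big_set1 setDv mesym1_set0 => /eqP.
by rewrite mulf_eq0 (negbTE (weight_neq0 _)) => /eqP.
Qed.

End BraidIdeal.

(** * Failure of the Weak Lefschetz Property for every initial ideal *)

Section BraidInitial.
Variable K : fieldType.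
Hypothesis charK0 : [pchar K] =i pred0.
Local Notation I := (aot_ideal (@braid_form K)).
Local Notation z := (ord_max : 'I_7).
Variable le : rel 'X_{1..7}.
Hypothesis leP : monomial_order le.
Local Notation lead := (leading le I).

Lemma braid_lead_square i : lead (U_(i) + U_(i))%MM.
Proof.
exists ('X_i * 'X_i); first exact: square_aot.
case: leP => [[lexx _ _ _] _]; rewrite -mpolyXD /is_leading_monomial msuppX.
by split=> [|u]; rewrite inE // => /eqP->.
Qed.

(** Adding [y] to [T] gives at least four forms in x_1, x_2, x_3 alone, and [y] is the smallest of
    their variables; [leading_rank] then removes [y]. *)
Lemma braid_lead_cubic y (T : {set 'I_7}) : y != z ->
    (forall t, t != z -> le U_(y)%MM U_(t)%MM) ->
    T \subset ~: [set y; z] -> (2 < #|T|)%N ->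
  lead (mesym1 T).
Proof.
move=> yz ymin TD T2.
have TE t : t \in T -> (t != y) && (t != z).
  by move=> /(subsetP TD); rewrite !inE negb_or.
have yT : y \notin T by apply/negP => /TE; rewrite eqxx.
have Sz t : t \in y |: T -> t != z by rewrite !inE => /orP[/eqP->|/TE/andP[]].
rewrite -(setU1K yT); apply: (leading_rank leP (D := [set~ ord_max : 'I_4])
    (h := fun j => linfun (@coordinate K 4 j))
    (M := fun t j => (coef t j)%:~R)); rewrite ?setU11 //.
- move=> t /Sz tz; rewrite /braid_form (bigD1 ord_max) //=.
  have -> : coef t 3 = 0.
    have tab : all (fun t => (t == 6%N) || (coef t 3 == 0)) (iota 0 7) by lazy.
    by have /orP[t6|/eqP//] := all_iota t tab; case/negP: tz.
  by rewrite mulr0z scale0r add0r; apply: eq_bigl => j; rewrite !inE.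
- by rewrite cardsC1 card_ord cardsU1 yT add1n ltnS.
by move=> t /Sz; apply: ymin.
Qed.

Lemma braid_std_pair i : i != z -> ~ lead (mesym1 [set i; z]).
Proof.
move=> iz [f If [+ _]]; rewrite mcoeff_msupp => /negP; apply.
have iF : [:: val i; 6%N] \in flats.
  by case: i iz => [[|[|[|[|[|[|[]]]]]]]].
suff -> : [set i; z] = oset [:: val i; 6%N] by rewrite (mcoeff_flat iF If).
by apply/setP => j; rewrite !inE -!val_eqE.
Qed.

(** The six tables together form a vector-valued functional that vanishes on the ideal and takes the
    unit vectors as values on [nbc_bases], as [standard_set] requires. *)
Lemma braid_std_quartic : exists W : {set {set 'I_7}}, (5 < #|W|)%N /\
  forall A, A \in W -> #|A| = 4 /\ ~ lead (mesym1 A).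
Proof.
pose v (A : {set 'I_7}) : 'rV[K]_6 := \row_k phi K (nth [::] top_tables k) A.
have vI f : I f -> \sum_A f@_(mesym1 A) *: v A = 0.
  move=> If; apply/rowP => k; rewrite summxE mxE.
  rewrite -[RHS](phi_aot (all_nthP [::] top_tables_kill k (ltn_ord k)) If).
  by apply: eq_bigr => A _; rewrite !mxE.
have vfull k : exists A, v A = delta_mx 0 k.
  exists (oset (nth [::] nbc_bases k)); apply/rowP => i; rewrite !mxE /phi code_oset.
  have -> : [seq j <- iota 0 7 | j \in nth [::] nbc_bases k] = nth [::] nbc_bases k.
    by apply/eqP/(all_iota (P := fun k => [seq j <- iota 0 7 | j \in nth [::] nbc_bases k]
      == nth [::] nbc_bases k) k); lazy.
  rewrite top_tables_bases ?ltn_ord // eqxx -val_eqE /=.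
  by case: (nat_of_ord i == k).
have [W [W6 v0 stdW]] := standard_set leP vI vfull.
exists W; split=> // A AW; split; last exact: stdW.
(* If [v A] is nonzero, [code A] is a key of one of the tables, and all keys have four elements. *)
have size4 s u : s \in top_tables -> lookup s u != 0 -> size u = 4.
  have /allP all4 : all (fun s : table => all (fun uc => size uc.1 == 4%N) s)
    top_tables by lazy.
  move=> /all4; elim: s => //= -[u' c] s IHs /andP[/eqP u4 /IHs].
  by case: (eqVneq u u') => [->|].
apply/eqP; rewrite cardE -(size_map val) -/(code A).
have [k vk] : exists k, v A 0 k != 0 by apply/rV0Pn/v0.
apply/eqP/(size4 (nth [::] top_tables k)); first exact: mem_nth.
by apply: contraNneq vk => s0; rewrite mxE /phi s0.
Qed.

Lemma braid_not_WLP : ~ WLP (initial_ideal le I).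
Proof.
have /(min_variable leP)[y yz ymin] : (ord0 : 'I_7) \in [set~ z] by rewrite !inE.
rewrite !inE in yz; have [W [W6 stdW]] := braid_std_quartic.
apply: (@not_WLP_initial K 7 I le leP _ _ y z W) => //.
- by move=> p f; apply: ideal_genM.
- by rewrite (pcharf0P K).1.
- exact: braid_lead_square.
- by move=> T; apply: braid_lead_cubic => // t tz; apply: ymin; rewrite !inE.
- exact: braid_std_pair.
by rewrite cardsCs setCK card_ord cards2 yz.
Qed.

End BraidInitial.

Theorem proposition3p3 (K : fieldType) (charK0 : [pchar K] =i pred0) :
  exists (n d : nat) (l : 'I_d -> 'Hom('rV[K]_n, K^o)),
    [/\ is_arrangement l,
        WLP (aot_ideal l) &
        forall le : rel 'X_{1..d}, monomial_order le ->
          ~ WLP (initial_ideal le (aot_ideal l))].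
Proof.
exists 4, 7, (@braid_form K); split; first exact: form_arrangement.
  exact: braid_WLP.
by move=> le leP; apply: braid_not_WLP.
Qed.
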